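(* Let $n\ge3$ be an integer. There exist real numbers $\beta_l$ and $\beta_r$ with $1\in(\beta_l,\beta_r)$ such that for each $\beta\in(\beta_l,\beta_r)$ the potential $U_\beta$ has exactly $n+1$ critical points. In particular, for each $\beta\in(\beta_l,\beta_r)$ the potential $U_\beta$ has only one critical point different from the origin on each perpendicular bisector to the sides of the regular $n$-gon, and a critical point at the origin.
   Context: Positive unit point charges are placed at the vertices $\zeta_n^j=e^{2\pi i j/n}$, $j=1,\dots,n$, of a regular $n$-gon inscribed in the unit circle. For real $\beta$ and $z=re^{i\theta}$ with $r\in[0,1)$, $\theta\in[0,2\pi)$, the Riesz potential is $$U_\beta(r,\theta)=\sum_{j=1}^n|z-\zeta_n^j|^{-2\beta}=\sum_{j=1}^n\frac{1}{(1+r^2-2r\cos(2\pi j/n-\theta))^{\beta}}.$$ It is regarded as a smooth function on the open unit disc in $\mathbb{R}^2\cong\mathbb{C}$; a critical point is a point of the open unit disc where its gradient vanishes. The perpendicular bisectors to the sides of the polygon are understood as the rays from the origin $\theta=\pi k/n$, $k=1,3,5,\dots,2n-1$. *)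

(* Defs.v *)
From Stdlib Require Export Reals List.
From Coquelicot Require Export Coquelicot.

Open Scope R_scope.

Definition polar (r theta : R) : C := (r * cos theta, r * sin theta).

Definition vertex (n j : nat) : C := polar 1 (2 * PI * INR j / INR n).

(* [Rpower] is exponentiation only for a positive base.  The base here is positive
   at every point of the open unit disc; the values elsewhere play no role,
   differentiability at a point of the disc being a local property. *)
Definition riesz_potential (n : nat) (beta : R) (z : C) : R :=
  sum_n_m (fun j => Rpower (Cmod (z - vertex n j)) (-2 * beta)) 1 n.

(* [f] is differentiable at [z], as a function of two real variables, with
   gradient [g] under the identification of C with R^2. *)
Definition is_gradient (f : C -> R) (z g : C) : Prop :=
  differentiable_pt_lim (fun x y => f (x, y)) (Re z) (Im z) (Re g) (Im g).

Definition critical_point (f : C -> R) (z : C) : Prop :=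
  Cmod z < 1 /\ is_gradient f z 0.

Definition on_ray (theta : R) (z : C) : Prop :=
  exists r : R, 0 <= r /\ z = polar r theta.

Definition has_exactly {T : Type} (m : nat) (P : T -> Prop) : Prop :=
  exists s : list T, NoDup s /\ length s = m /\ forall x, In x s <-> P x.

(* Main.v *)
Require Import Defs.
From Stdlib Require Import ZArith Lra Lia Ranalysis5 ClassicalEpsilon FinFun.

(* At [b = 1] the Poisson kernel gives the closed form
     U = n (1 - r^2n) / ((1 - r^2) (1 - 2 r^n cos (n t) + r^2n)),
   so in the sector [0 <= t <= pi/n] the only critical points are the origin and
   one nondegenerate saddle on the bisector [t = pi/n].  This persists for [b]
   near 1 by compactness of [0 <= r <= 1], [0 <= t <= pi/n], since every point
   [(r0, t0)] of this rectangle has a neighbourhood, uniform in [b], which is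
   under control: at [r0 = 0], U_rr = 2 n b^2 > 0; at [r0 = 1] off the vertices,
   U_r = - b U < 0; at the vertex the nearest charge dominates; at the saddle,
   U_t vanishes on the bisector by reflection and U_tt <> 0, so critical points
   stay on the bisector, where U_rr <> 0 makes them unique; elsewhere the
   gradient at [b = 1] does not vanish.  Existence on the bisector is the
   intermediate value theorem, U_r being positive for small [r] and negative at
   [r = 1].  The symmetries of the polygon carry the sector to the whole disc. *)

(** * Finite sums indexed from 1 *)

Lemma sum_1_S (f : nat -> R) (m : nat) :
  sum_n_m f 1 (S m) = sum_n_m f 1 m + f (S m).
Proof. apply (sum_n_Sm f 1 m); lia. Qed.

Lemma sum_1_0 (f : nat -> R) : sum_n_m f 1 0 = 0.
Proof. apply (sum_n_m_zero f 1 0); lia. Qed.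

Lemma sum_1_eq (f g : nat -> R) (m : nat) :
  (forall j, (1 <= j <= m)%nat -> f j = g j) -> sum_n_m f 1 m = sum_n_m g 1 m.
Proof. apply sum_n_m_ext_loc. Qed.

Lemma sum_1_plus (f g : nat -> R) (m : nat) :
  sum_n_m (fun j => f j + g j) 1 m = sum_n_m f 1 m + sum_n_m g 1 m.
Proof. apply (sum_n_m_plus f g 1 m). Qed.

Lemma sum_1_scal (a : R) (f : nat -> R) (m : nat) :
  sum_n_m (fun j => a * f j) 1 m = a * sum_n_m f 1 m.
Proof. apply (sum_n_m_mult_l (K := R_Ring) a f 1 m). Qed.

Lemma sum_1_const (a : R) (m : nat) : sum_n_m (fun _ => a) 1 m = INR m * a.
Proof. rewrite sum_n_m_const; do 2 f_equal; lia. Qed.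

Lemma sum_1_nonneg (f : nat -> R) (m : nat) :
  (forall j, (1 <= j <= m)%nat -> 0 < f j) -> 0 <= sum_n_m f 1 m.
Proof.
  induction m as [|m IH]; intros H; [rewrite sum_1_0; lra|].
  rewrite sum_1_S.
  assert (0 < f (S m)) by (apply H; lia).
  assert (0 <= sum_n_m f 1 m) by (apply IH; intros; apply H; lia).
  lra.
Qed.

Lemma sum_1_pos (f : nat -> R) (m : nat) :
  (1 <= m)%nat -> (forall j, (1 <= j <= m)%nat -> 0 < f j) -> 0 < sum_n_m f 1 m.
Proof.
  destruct m as [|m]; intros Hm H; [lia|].
  rewrite sum_1_S.
  assert (0 < f (S m)) by (apply H; lia).
  assert (0 <= sum_n_m f 1 m) by (apply sum_1_nonneg; intros; apply H; lia).
  lra.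
Qed.

(** The reversal j -> m - j carries 1..m to 0..m-1, so the two end terms make up the difference. It
    serves the reflection of the polygon. *)
Lemma sum_1_rev (f : nat -> R) (m : nat) :
  sum_n_m (fun j => f (m - j)%nat) 1 m + f m = f 0%nat + sum_n_m f 1 m.
Proof.
  assert (E : forall (g : nat -> R) k,
             sum_n_m g 1 (S k) = g 1%nat + sum_n_m (fun j => g (S j)) 1 k).
  { intros g k; induction k as [|k IH]; [rewrite sum_1_S, !sum_1_0; lra|].
    rewrite sum_1_S, IH, (sum_1_S (fun j => g (S j)) k); lra. }
  induction m as [|m IH]; [rewrite !sum_1_0; lra|].
  rewrite E, sum_1_S.
  replace (S m - 1)%nat with m by lia.
  rewrite (sum_1_eq _ (fun j => f (m - j)%nat)); [lra|].
  intros; f_equal; lia.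
Qed.

Lemma sum_1_is_derive (f : nat -> R -> R) (d : nat -> R) (x : R) (m : nat) :
  (forall j, (1 <= j <= m)%nat -> is_derive (f j) x (d j)) ->
  is_derive (fun y => sum_n_m (fun j => f j y) 1 m) x (sum_n_m d 1 m).
Proof.
  induction m as [|m IH]; intros H.
  - rewrite sum_1_0.
    apply (is_derive_ext (fun _ => 0)); [intros; now rewrite sum_1_0|].
    auto_derive; trivial.
  - rewrite sum_1_S.
    apply (is_derive_ext (fun y => sum_n_m (fun j => f j y) 1 m + f (S m) y)).
    { intros y; now rewrite sum_1_S. }
    apply (is_derive_plus (V := R_NormedModule) (fun y => sum_n_m (fun j => f j y) 1 m) (f (S m))).
    + apply IH; intros; apply H; lia.
    + apply H; lia.
Qed.

Lemma sum_1_continuous {T : UniformSpace} (f : nat -> T -> R) (x : T) (m : nat) :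
  (forall j, (1 <= j <= m)%nat -> continuous (f j) x) ->
  continuous (fun y => sum_n_m (fun j => f j y) 1 m) x.
Proof.
  induction m as [|m IH]; intros H.
  - apply (continuous_ext (fun _ => 0)); [intros; now rewrite sum_1_0|].
    apply continuous_const.
  - apply (continuous_ext (fun y => sum_n_m (fun j => f j y) 1 m + f (S m) y)).
    { intros y; now rewrite sum_1_S. }
    apply (continuous_plus (V := R_NormedModule)).
    + apply IH; intros; apply H; lia.
    + apply H; lia.
Qed.

(** The partial derivatives stay existential: only differentiability is wanted, their values being
    recovered later along rays and circles. *)
Lemma sum_1_differentiable (f : nat -> R -> R -> R) (x y : R) (m : nat) :
  (forall j, (1 <= j <= m)%nat ->
     exists lx ly, differentiable_pt_lim (f j) x y lx ly) ->
  exists lx ly,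
    differentiable_pt_lim (fun u v => sum_n_m (fun j => f j u v) 1 m) x y lx ly.
Proof.
  induction m as [|m IH]; intros H.
  - exists 0, 0; intros eps; exists eps; intros u v _ _.
    rewrite !sum_1_0, !Rmult_0_l, Rplus_0_l, !Rminus_0_r, Rabs_R0.
    apply Rmult_le_pos; [apply Rlt_le, cond_pos|].
    apply Rle_trans with (1 := Rabs_pos (u - x)), Rmax_l.
  - destruct IH as (l1 & l2 & Hl); [intros; apply H; lia|].
    destruct (H (S m)) as (k1 & k2 & Hk); [lia|].
    exists (l1 + k1), (l2 + k2).
    apply filterdiff_differentiable_pt_lim in Hl.
    apply filterdiff_differentiable_pt_lim in Hk.
    apply filterdiff_differentiable_pt_lim.
    generalize (filterdiff_plus_fct _ _ _ _ Hl Hk); intros Hp.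
    apply (filterdiff_ext_lin _ (fun u : R * R =>
             plus (fst u * l1 + snd u * l2) (fst u * k1 + snd u * k2))).
    + revert Hp; apply filterdiff_ext; intros u.
      now rewrite sum_1_S.
    + intros [u v]; simpl; unfold plus; simpl; lra.
Qed.

(** * Sums over the vertices and their dihedral symmetry *)

(** Common form of the potential and its polar derivatives: each vertex contributes through the
    angle measured from it. *)
Definition gon_sum (n : nat) (f : R -> R) (t : R) : R :=
  sum_n_m (fun j => f (t - 2 * PI * INR j / INR n)) 1 n.

Section Symmetry.

Variables (n : nat) (f : R -> R).
Hypothesis hn : (1 <= n)%nat.
Hypothesis hf : forall p, f (p + 2 * PI) = f p.

Let hN : 0 < INR n.
Proof. apply lt_0_INR; lia. Qed.

(** The rotation renumbers the vertices by one; the sums differ by [g (S n)] against [g 1], equal by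
    periodicity. *)
Lemma gon_sum_shift t : gon_sum n f (t + 2 * PI / INR n) = gon_sum n f t.
Proof.
  unfold gon_sum.
  set (g := fun j : nat => f (t + 2 * PI / INR n - 2 * PI * INR j / INR n)).
  rewrite (sum_1_eq (fun j => f (t - 2 * PI * INR j / INR n)) (fun j => g (S j))).
  2:{ intros j _; unfold g; rewrite S_INR; f_equal; field; lra. }
  assert (E : forall m, sum_n_m (fun j => g (S j)) 1 m + g 1%nat = sum_n_m g 1 m + g (S m)).
  { induction m as [|m IH]; [rewrite !sum_1_0; lra|].
    rewrite (sum_1_S (fun j => g (S j))), (sum_1_S g); lra. }
  assert (g (S n) = g 1%nat); [|specialize (E n); lra].
  unfold g; rewrite <- hf; f_equal; rewrite S_INR; simpl; field; lra.
Qed.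

Lemma gon_sum_shift_nat t (k : nat) :
  gon_sum n f (t + INR k * (2 * PI / INR n)) = gon_sum n f t.
Proof.
  induction k as [|k IH].
  - f_equal; simpl; lra.
  - rewrite <- IH, <- (gon_sum_shift (t + INR k * _)), S_INR; f_equal; ring.
Qed.

Lemma gon_sum_shift_Z t (k : Z) :
  gon_sum n f (t + IZR k * (2 * PI / INR n)) = gon_sum n f t.
Proof.
  destruct (Z.le_ge_cases 0 k) as [H|H].
  - rewrite <- (Z2Nat.id k H), <- INR_IZR_INZ; apply gon_sum_shift_nat.
  - rewrite <- (gon_sum_shift_nat _ (Z.to_nat (- k))); f_equal.
    rewrite (INR_IZR_INZ (Z.to_nat _)), Z2Nat.id, opp_IZR by lia; ring.
Qed.

(** Reflection exchanges the vertices j and n - j. The factor [e] is the parity of [f], to be used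
    with 1 and -1. *)
Lemma gon_sum_reflect e t :
  (forall p, f (- p) = e * f p) -> gon_sum n f (- t) = e * gon_sum n f t.
Proof.
  intros He; unfold gon_sum.
  rewrite <- sum_1_scal.
  set (g := fun j : nat => e * f (t - 2 * PI * INR j / INR n)).
  rewrite (sum_1_eq _ (fun j => g (n - j)%nat)).
  2:{ intros j Hj; unfold g; rewrite minus_INR by lia.
      rewrite <- He, <- hf; f_equal; field; lra. }
  assert (g n = g 0%nat).
  { unfold g; rewrite <- (hf (t - _)); do 2 f_equal; simpl; field; lra. }
  generalize (sum_1_rev g n); lra.
Qed.

End Symmetry.

(** * The potential of one charge and its polar derivatives *)

(** This is |r e^(ip) - 1|^2; a vertex at angle a only replaces p by p - a. *)
Definition sqdist (r p : R) : R := 1 + r ^ 2 - 2 * r * cos p.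

Definition pot (b r p : R) : R := Rpower (sqdist r p) (- b).
Definition pot_r (b r p : R) : R :=
  - b * Rpower (sqdist r p) (- b - 1) * (2 * r - 2 * cos p).
Definition pot_t (b r p : R) : R :=
  - b * Rpower (sqdist r p) (- b - 1) * (2 * r * sin p).
Definition pot_rr (b r p : R) : R :=
  b * (b + 1) * Rpower (sqdist r p) (- b - 2) * (2 * r - 2 * cos p) ^ 2
  - 2 * b * Rpower (sqdist r p) (- b - 1).
Definition pot_tt (b r p : R) : R :=
  b * (b + 1) * Rpower (sqdist r p) (- b - 2) * (2 * r * sin p) ^ 2
  - b * Rpower (sqdist r p) (- b - 1) * (2 * r * cos p).

Lemma sqdist_sos r p : sqdist r p = (r - cos p) ^ 2 + sin p ^ 2.
Proof. generalize (sin2_cos2 p); unfold sqdist, Rsqr; nra. Qed.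

Lemma sqdist_pos r p : -1 < r < 1 -> 0 < sqdist r p.
Proof.
  intros H; generalize (COS_bound p); unfold sqdist; intros.
  destruct (Rle_lt_dec 0 r); nra.
Qed.

Lemma is_derive_Rpower_comp (f : R -> R) (x l c : R) :
  0 < f x -> is_derive f x l ->
  is_derive (fun y => Rpower (f y) c) x (c * Rpower (f x) (c - 1) * l).
Proof.
  intros Hp Hf; unfold Rpower.
  auto_derive.
  - repeat split; trivial; now exists l.
  - replace (Derive (fun y => f y) x) with l by (symmetry; exact (is_derive_unique _ _ _ Hf)).
    replace ((c - 1) * ln (f x)) with (c * ln (f x) - ln (f x)) by ring.
    unfold Rminus; rewrite exp_plus, exp_Ropp, exp_ln by trivial; field; lra.
Qed.

Lemma is_derive_scal_mult (f g : R -> R) (c x lf lg : R) :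
  is_derive f x lf -> is_derive g x lg ->
  is_derive (fun y => c * f y * g y) x (c * lf * g x + c * f x * lg).
Proof.
  intros Hf Hg; auto_derive.
  - repeat split; eexists; eassumption.
  - replace (Derive (fun y => f y) x) with lf by (symmetry; exact (is_derive_unique _ _ _ Hf)).
    replace (Derive (fun y => g y) x) with lg by (symmetry; exact (is_derive_unique _ _ _ Hg)).
    ring.
Qed.

Lemma is_derive_pot_r b r p :
  0 < sqdist r p -> is_derive (fun s => pot b s p) r (pot_r b r p).
Proof.
  intros H; apply (is_derive_Rpower_comp (fun s => sqdist s p)); trivial.
  unfold sqdist; auto_derive; trivial; ring.
Qed.

Lemma is_derive_pot_t b r p :
  0 < sqdist r p -> is_derive (fun q => pot b r q) p (pot_t b r p).
Proof.
  intros H; apply (is_derive_Rpower_comp (sqdist r)); trivial.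
  unfold sqdist; auto_derive; trivial; ring.
Qed.

Lemma is_derive_pot_rr b r p :
  0 < sqdist r p -> is_derive (fun s => pot_r b s p) r (pot_rr b r p).
Proof.
  intros H.
  evar_last.
  - apply (is_derive_scal_mult (fun s => Rpower (sqdist s p) (- b - 1))
             (fun s => 2 * s - 2 * cos p)).
    + apply (is_derive_Rpower_comp (fun s => sqdist s p)); trivial.
      unfold sqdist; auto_derive; trivial; reflexivity.
    + auto_derive; trivial; reflexivity.
  - unfold pot_rr; replace (- b - 1 - 1) with (- b - 2) by ring; simpl; ring.
Qed.

Lemma is_derive_pot_tt b r p :
  0 < sqdist r p -> is_derive (fun q => pot_t b r q) p (pot_tt b r p).
Proof.
  intros H.
  evar_last.
  - apply (is_derive_scal_mult (fun q => Rpower (sqdist r q) (- b - 1))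
             (fun q => 2 * r * sin q)).
    + apply (is_derive_Rpower_comp (sqdist r)); trivial.
      unfold sqdist; auto_derive; trivial; reflexivity.
    + auto_derive; trivial; reflexivity.
  - unfold pot_tt; replace (- b - 1 - 1) with (- b - 2) by ring; simpl; ring.
Qed.

(** * Joint continuity in exponent, radius and angle *)

Definition cont3 (F : R -> R -> R -> R) (b r t : R) : Prop :=
  continuous (fun p : R * R * R => F (fst (fst p)) (snd (fst p)) (snd p)) (b, r, t).

Lemma continuous_Rpower {T : UniformSpace} (f g : T -> R) (x : T) :
  0 < f x -> continuous f x -> continuous g x ->
  continuous (fun y => Rpower (f y) (g y)) x.
Proof.
  intros Hp Hf Hg; unfold Rpower.
  apply (continuous_comp (fun y => g y * ln (f y)) exp); [|apply continuous_exp].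
  apply (continuous_mult (K := R_AbsRing)); trivial.
  apply (continuous_comp f ln); trivial; now apply continuous_ln.
Qed.

Lemma cont3_const a b r t : cont3 (fun _ _ _ => a) b r t.
Proof. apply continuous_const. Qed.

Lemma cont3_1 b r t : cont3 (fun b _ _ => b) b r t.
Proof. apply (continuous_comp fst fst); apply continuous_fst. Qed.

Lemma cont3_2 b r t : cont3 (fun _ r _ => r) b r t.
Proof. apply (continuous_comp fst snd); [apply continuous_fst|apply continuous_snd]. Qed.

Lemma cont3_3 b r t : cont3 (fun _ _ t => t) b r t.
Proof. apply continuous_snd. Qed.

Lemma cont3_opp f b r t : cont3 f b r t -> cont3 (fun b r t => - f b r t) b r t.
Proof. apply (continuous_opp (V := R_NormedModule)). Qed.

Lemma cont3_plus f g b r t :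
  cont3 f b r t -> cont3 g b r t -> cont3 (fun b r t => f b r t + g b r t) b r t.
Proof. apply (continuous_plus (V := R_NormedModule)). Qed.

Lemma cont3_minus f g b r t :
  cont3 f b r t -> cont3 g b r t -> cont3 (fun b r t => f b r t - g b r t) b r t.
Proof. apply (continuous_minus (V := R_NormedModule)). Qed.

Lemma cont3_mult f g b r t :
  cont3 f b r t -> cont3 g b r t -> cont3 (fun b r t => f b r t * g b r t) b r t.
Proof. apply (continuous_mult (K := R_AbsRing)). Qed.

Lemma cont3_comp g f b r t :
  continuous g (f b r t) -> cont3 f b r t -> cont3 (fun b r t => g (f b r t)) b r t.
Proof.
  intros Hg Hf.
  now apply (continuous_comp (fun p : R * R * R => f (fst (fst p)) (snd (fst p)) (snd p)) g).
Qed.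

Lemma cont3_Rpower f g b r t :
  0 < f b r t -> cont3 f b r t -> cont3 g b r t ->
  cont3 (fun b r t => Rpower (f b r t) (g b r t)) b r t.
Proof.
  intros H Hf Hg.
  now apply (continuous_Rpower (fun p : R * R * R => f (fst (fst p)) (snd (fst p)) (snd p))
           (fun p : R * R * R => g (fst (fst p)) (snd (fst p)) (snd p))).
Qed.

(** Descends through the syntax of the curried function; the base of each [Rpower] must be positive,
    which is sought among the hypotheses. *)
Ltac continuity3 :=
  lazymatch goal with
  | |- cont3 (fun _ _ _ => ?a) _ _ _ => apply cont3_const
  | |- cont3 (fun b _ _ => b) _ _ _ => apply cont3_1
  | |- cont3 (fun _ r _ => r) _ _ _ => apply cont3_2
  | |- cont3 (fun _ _ t => t) _ _ _ => apply cont3_3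
  | |- cont3 (fun b r t => @?f b r t + @?g b r t) _ _ _ =>
      apply (cont3_plus f g); continuity3
  | |- cont3 (fun b r t => @?f b r t - @?g b r t) _ _ _ =>
      apply (cont3_minus f g); continuity3
  | |- cont3 (fun b r t => @?f b r t * @?g b r t) _ _ _ =>
      apply (cont3_mult f g); continuity3
  | |- cont3 (fun b r t => - @?f b r t) _ _ _ => apply (cont3_opp f); continuity3
  | |- cont3 (fun b r t => @?f b r t ^ 2) _ _ _ =>
      apply (cont3_comp (fun x => x ^ 2) f);
      [apply (ex_derive_continuous (fun x => x ^ 2)); auto_derive; trivial|continuity3]
  | |- cont3 (fun b r t => cos (@?f b r t)) _ _ _ =>
      apply (cont3_comp cos f); [apply continuous_cos|continuity3]
  | |- cont3 (fun b r t => sin (@?f b r t)) _ _ _ =>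
      apply (cont3_comp sin f); [apply continuous_sin|continuity3]
  | |- cont3 (fun b r t => Rpower (@?f b r t) (@?g b r t)) _ _ _ =>
      apply (cont3_Rpower f g); [try assumption|continuity3|continuity3]
  end.

Lemma cont3_pot_r b r t : 0 < sqdist r t -> cont3 pot_r b r t.
Proof.
  (* The eta-expansion exposes, after unfolding, the body that [continuity3] matches. *)
  intros H; change (cont3 (fun b r t => pot_r b r t) b r t).
  unfold pot_r, sqdist; continuity3.
Qed.

Lemma cont3_pot_t b r t : 0 < sqdist r t -> cont3 pot_t b r t.
Proof.
  intros H; change (cont3 (fun b r t => pot_t b r t) b r t).
  unfold pot_t, sqdist; continuity3.
Qed.

Lemma cont3_pot_rr b r t : 0 < sqdist r t -> cont3 pot_rr b r t.
Proof.
  intros H; change (cont3 (fun b r t => pot_rr b r t) b r t).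
  unfold pot_rr, sqdist; continuity3.
Qed.

Lemma cont3_pot_tt b r t : 0 < sqdist r t -> cont3 pot_tt b r t.
Proof.
  intros H; change (cont3 (fun b r t => pot_tt b r t) b r t).
  unfold pot_tt, sqdist; continuity3.
Qed.

Lemma cont3_shift F a b r t : cont3 F b r (t - a) -> cont3 (fun b r t => F b r (t - a)) b r t.
Proof.
  intros H; unfold cont3.
  apply (continuous_comp (fun p : R * R * R => (fst p, snd p - a))
           (fun p : R * R * R => F (fst (fst p)) (snd (fst p)) (snd p))); [|exact H].
  apply (continuous_comp_2 (fun p : R * R * R => fst p) (fun p : R * R * R => snd p - a)
           (fun (q : R * R) (s : R) => (q, s))).
  - apply continuous_fst.
  - apply (continuous_minus (V := R_NormedModule));
      [apply continuous_snd|apply continuous_const].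
  - apply (continuous_ext (fun x => x)); [now intros []|apply continuous_id].
Qed.

Lemma cont3_sum (F : nat -> R -> R -> R -> R) b r t m :
  (forall j, (1 <= j <= m)%nat -> cont3 (F j) b r t) ->
  cont3 (fun b r t => sum_n_m (fun j => F j b r t) 1 m) b r t.
Proof.
  intros H; unfold cont3.
  now apply (sum_1_continuous (fun j (p : R * R * R) => F j (fst (fst p)) (snd (fst p)) (snd p))).
Qed.

Lemma cont3_gon_sum n F b r t :
  (forall j, (1 <= j <= n)%nat -> cont3 F b r (t - 2 * PI * INR j / INR n)) ->
  cont3 (fun b r => gon_sum n (F b r)) b r t.
Proof.
  intros H; apply (cont3_sum (fun j b r t => F b r (t - 2 * PI * INR j / INR n))).
  intros j Hj; now apply cont3_shift, H.
Qed.

Definition near3 (d b0 r0 t0 b r t : R) : Prop :=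
  Rabs (b - b0) < d /\ Rabs (r - r0) < d /\ Rabs (t - t0) < d.

Lemma cont3_near F b0 r0 t0 e :
  cont3 F b0 r0 t0 -> 0 < e ->
  exists d, 0 < d /\ forall b r t, near3 d b0 r0 t0 b r t -> Rabs (F b r t - F b0 r0 t0) < e.
Proof.
  intros H He.
  destruct (proj1 (filterlim_locally _ _) H (mkposreal e He)) as [d Hd].
  exists d; split; [apply cond_pos|].
  intros b r t (Hb & Hr & Ht).
  apply (Hd (b, r, t)); repeat split; assumption.
Qed.

(** The positive product treats both signs at once, and also the case where only nonvanishing is
    known. *)
Lemma cont3_same_sign F b0 r0 t0 :
  cont3 F b0 r0 t0 -> F b0 r0 t0 <> 0 ->
  exists d, 0 < d /\ forall b r t, near3 d b0 r0 t0 b r t -> 0 < F b0 r0 t0 * F b r t.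
Proof.
  intros H He.
  destruct (cont3_near _ _ _ _ _ H (Rabs_pos_lt _ He)) as (d & Hd & Hn).
  exists d; split; trivial.
  intros b r t Hb; specialize (Hn b r t Hb).
  revert Hn; unfold Rabs; destruct (Rcase_abs (_ - _)), (Rcase_abs (F b0 r0 t0)); nra.
Qed.

(** * Mean value theorem and monotonicity of powers *)

Lemma MVT_is_derive (f df : R -> R) (a b : R) :
  a < b -> (forall x, a <= x <= b -> is_derive f x (df x)) ->
  exists c, a < c < b /\ f b - f a = df c * (b - a).
Proof.
  intros Hab H.
  destruct (MVT_cor2 f df a b Hab) as (c & E & Hc).
  { intros x Hx; now apply is_derive_Reals, H. }
  now exists c.
Qed.

Lemma Rolle_is_derive (f df : R -> R) (a b : R) :
  a < b -> (forall x, a <= x <= b -> is_derive f x (df x)) -> f a = f b ->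
  exists c, a < c < b /\ df c = 0.
Proof.
  intros Hab H E; destruct (MVT_is_derive f df a b Hab H) as (c & Hc & Ec).
  exists c; split; trivial.
  apply Rmult_eq_reg_r with (b - a); lra.
Qed.

Lemma pow_lt_1 (x : R) (m : nat) : (1 <= m)%nat -> 0 <= x < 1 -> 0 <= x ^ m < 1.
Proof.
  intros Hm Hx; split; [now apply pow_le|].
  apply pow_lt_1_compat; [lra|lia].
Qed.

Lemma pow_lt_l (x y : R) (m : nat) : (1 <= m)%nat -> 0 < x < y -> x ^ m < y ^ m.
Proof.
  intros Hm H; destruct m as [|m]; [lia|clear Hm].
  induction m as [|m IH]; [lra|].
  change (x * x ^ S m < y * y ^ S m).
  generalize (pow_lt x (S m)); nra.
Qed.

(** * The radial equation of the saddle at exponent 1 *)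

Section Saddle.

Variable n : nat.
Hypothesis hn : (3 <= n)%nat.

Let hN : 3 <= INR n.
Proof. replace 3 with (INR 3) by (simpl; lra); now apply le_INR. Qed.

(* On the bisector, at [b = 1], U_r is a positive multiple of this function. *)
Definition saddle_fun (r : R) : R := 1 - r ^ (2 * n) - INR n * r ^ (n - 2) + INR n * r ^ n.
Definition saddle_factor (r : R) : R := 2 * r ^ (n + 2) - INR n * r ^ 2 + INR n - 2.
Definition saddle_der (r : R) : R := - (INR n * r ^ (n - 3) * saddle_factor r).

Lemma is_derive_saddle_fun r : is_derive saddle_fun r (saddle_der r).
Proof.
  unfold saddle_fun, saddle_der, saddle_factor.
  auto_derive; trivial.
  replace (INR (n - 2)) with (INR n - 2) by (rewrite minus_INR by lia; simpl; lra).
  replace (INR (n + (n + 0))) with (2 * INR n) by (rewrite !plus_INR; simpl; lra).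
  destruct n as [|[|[|m]]]; try lia.
  replace (pred (S (S (S m)) + (S (S (S m)) + 0))) with (m + m + 5)%nat by lia.
  replace (pred (S (S (S m)) - 2)) with m by lia.
  replace (S (S (S m)) - 3)%nat with m by lia.
  replace (pred (S (S (S m)))) with (m + 2)%nat by lia.
  replace (S (S (S m)) + 2)%nat with (m + 5)%nat by lia.
  rewrite !pow_add; ring.
Qed.

(** With the root at 1 there would be three roots, hence by Rolle two positive zeros of 2 r ((n + 2)
    r^n - n), which has only one because r^n is strictly increasing. *)
Lemma saddle_factor_roots x y : 0 < x -> x < y -> y < 1 -> saddle_factor x = 0 -> saddle_factor y = 0 -> False.
Proof.
  intros Hx Hxy Hy Ex Ey.
  set (dL := fun r => 2 * r * ((INR n + 2) * r ^ n - INR n)).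
  assert (D : forall r, is_derive saddle_factor r (dL r)).
  { intros r; unfold saddle_factor, dL; auto_derive; trivial.
    rewrite plus_INR; replace (pred (n + 2)) with (n + 1)%nat by lia.
    rewrite pow_add; simpl; ring. }
  assert (E1 : saddle_factor 1 = 0) by (unfold saddle_factor; rewrite !pow1; ring).
  destruct (Rolle_is_derive saddle_factor dL x y) as (c & Hc & Ec); [lra|now intros|lra|].
  destruct (Rolle_is_derive saddle_factor dL y 1) as (d & Hd & Ed); [lra|now intros|lra|].
  assert (P : forall r, 0 < r -> dL r = 0 -> r ^ n = INR n / (INR n + 2)).
  { unfold dL; intros r Hr E; apply Rmult_integral in E; destruct E as [E|E]; [lra|].
    apply Rmult_eq_reg_r with (INR n + 2); [field_simplify; lra|lra]. }
  assert (c ^ n < d ^ n).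
  { apply pow_lt_l; [lia|lra]. }
  rewrite (P c), (P d) in H by lra; lra.
Qed.

Lemma saddle_fun_1 : saddle_fun 1 = 0.
Proof. unfold saddle_fun; rewrite !pow1; ring. Qed.

Lemma saddle_der_factor r : 0 < r -> saddle_der r = 0 -> saddle_factor r = 0.
Proof.
  unfold saddle_der; intros Hr H.
  assert (0 < r ^ (n - 3)) by now apply pow_lt.
  apply Rmult_eq_reg_l with (INR n * r ^ (n - 3)); [lra|nra].
Qed.

(** At a double root, x itself and a Rolle point between x and the root 1 would be two roots of
    [saddle_factor] in (0, 1). *)
Lemma saddle_root_simple x : 0 < x < 1 -> saddle_fun x = 0 -> saddle_der x <> 0.
Proof.
  intros Hx E H.
  destruct (Rolle_is_derive saddle_fun saddle_der x 1) as (c & Hc & Ec); [lra| | |].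
  - intros; apply is_derive_saddle_fun.
  - now rewrite saddle_fun_1.
  - apply saddle_der_factor in Ec; [|lra]. apply saddle_der_factor in H; [|lra].
    now apply (saddle_factor_roots x c).
Qed.

(** Rolle on [x, y] and on [y, 1] would give two roots of [saddle_factor] in (0, 1). *)
Lemma saddle_root_lt x y :
  0 < x -> x < y -> y < 1 -> saddle_fun x = 0 -> saddle_fun y = 0 -> False.
Proof.
  intros Hx Hxy Hy Ex Ey.
  destruct (Rolle_is_derive saddle_fun saddle_der x y) as (c & Hc & Ec);
    [lra|intros; apply is_derive_saddle_fun|lra|].
  destruct (Rolle_is_derive saddle_fun saddle_der y 1) as (d & Hd & Ed);
    [lra|intros; apply is_derive_saddle_fun|rewrite saddle_fun_1; lra|].
  apply saddle_der_factor in Ec; [|lra]. apply saddle_der_factor in Ed; [|lra].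
  apply (saddle_factor_roots c d); trivial; lra.
Qed.

Lemma saddle_root_unique x y :
  0 < x < 1 -> 0 < y < 1 -> saddle_fun x = 0 -> saddle_fun y = 0 -> x = y.
Proof.
  intros Hx Hy Ex Ey; destruct (Rtotal_order x y) as [H|[H|H]]; trivial; exfalso.
  - now apply (saddle_root_lt x y).
  - now apply (saddle_root_lt y x).
Qed.

End Saddle.

(** * Trigonometric sums and the closed form at exponent 1 *)

(** Real part of 1 + w + ... + w^m at w = r e^(ip); [geom_sin] is the imaginary part. *)
Definition geom_cos (r : R) (m : nat) (p : R) : R :=
  1 + sum_n_m (fun k => r ^ k * cos (INR k * p)) 1 m.
Definition geom_sin (r : R) (m : nat) (p : R) : R :=
  sum_n_m (fun k => r ^ k * sin (INR k * p)) 1 m.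

Section Trigonometric_sums.

Variable n : nat.
Hypothesis hn : (1 <= n)%nat.

Let hN : 0 < INR n.
Proof. apply lt_0_INR; lia. Qed.

Lemma gon_sum_ext f g t : (forall p, f p = g p) -> gon_sum n f t = gon_sum n g t.
Proof. intros H; apply sum_1_eq; intros; apply H. Qed.

Lemma gon_sum_plus f g t :
  gon_sum n (fun p => f p + g p) t = gon_sum n f t + gon_sum n g t.
Proof. apply (sum_1_plus (fun j => f _) (fun j => g _)). Qed.

Lemma gon_sum_scal a f t : gon_sum n (fun p => a * f p) t = a * gon_sum n f t.
Proof. apply (sum_1_scal a (fun j => f _)). Qed.

Lemma gon_sum_const a t : gon_sum n (fun _ => a) t = INR n * a.
Proof. apply (sum_1_const a n). Qed.

(** Multiplied by 2 sin(a/2), the sum telescopes to a difference of sines whose arguments differ by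
    n a = 2 pi k; and sin(a/2) > 0 since 0 < a/2 < pi. The free phase [x] gives the sine sums
    too. *)
Lemma sum_cos_arith (k : nat) (x : R) :
  (0 < k < n)%nat -> sum_n_m (fun j => cos (x - INR j * (2 * PI * INR k / INR n))) 1 n = 0.
Proof.
  intros Hk; set (a := 2 * PI * INR k / INR n).
  assert (E : forall m, 2 * sin (a / 2) * sum_n_m (fun j => cos (x - INR j * a)) 1 m
                = sin (x - a / 2) - sin (x - a / 2 - INR m * a)).
  { induction m as [|m IH].
    - rewrite sum_1_0; simpl; rewrite Rmult_0_l, Rminus_0_r; ring.
    - rewrite sum_1_S, Rmult_plus_distr_l, IH, S_INR.
      set (y := x - (INR m + 1) * a).
      replace (x - a / 2 - INR m * a) with (y + a / 2) by (unfold y; field).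
      replace (x - a / 2 - (INR m + 1) * a) with (y - a / 2) by (unfold y; field).
      rewrite (sin_plus y), (sin_minus y); ring. }
  assert (Hs : 0 < sin (a / 2)).
  { assert (0 < INR k) by (apply lt_0_INR; lia).
    assert (INR k < INR n) by (apply lt_INR; lia).
    generalize PI_RGT_0; intros HP.
    replace (a / 2) with (PI * (INR k / INR n)) by (unfold a; field; lra).
    assert (0 < INR k / INR n) by now apply Rdiv_lt_0_compat.
    assert (INR k / INR n < 1) by (apply Rmult_lt_reg_r with (INR n); trivial; field_simplify; lra).
    apply sin_gt_0; nra. }
  specialize (E n).
  replace (INR n * a) with (2 * INR k * PI) in E by (unfold a; field; lra).
  rewrite <- (sin_period (x - a / 2 - 2 * INR k * PI) k) in E.
  replace (x - a / 2 - 2 * INR k * PI + 2 * INR k * PI) with (x - a / 2) in E by ring.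
  apply Rmult_eq_reg_l with (2 * sin (a / 2)); lra.
Qed.

Lemma gon_sum_cos (k : nat) t : (0 < k < n)%nat -> gon_sum n (fun p => cos (INR k * p)) t = 0.
Proof.
  intros Hk; rewrite <- (sum_cos_arith k (INR k * t) Hk).
  apply sum_1_eq; intros j _; f_equal; field; lra.
Qed.

Lemma gon_sum_sin (k : nat) t : (0 < k < n)%nat -> gon_sum n (fun p => sin (INR k * p)) t = 0.
Proof.
  intros Hk; rewrite <- (sum_cos_arith k (INR k * t - PI / 2) Hk).
  apply sum_1_eq; intros j _; rewrite <- cos_shift, <- cos_neg; f_equal; field; lra.
Qed.


(* Real and imaginary parts of [(1 - w) (1 + w + ... + w^m) = 1 - w^(m+1)] at
   [w = r e^(ip)]. *)
Lemma geometric_sum r m p :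
  (1 - r * cos p) * geom_cos r m p + r * sin p * geom_sin r m p
    = 1 - r ^ (S m) * cos (INR (S m) * p) /\
  (1 - r * cos p) * geom_sin r m p - r * sin p * geom_cos r m p
    = - (r ^ (S m) * sin (INR (S m) * p)).
Proof.
  induction m as [|m [IHc IHs]].
  - unfold geom_cos, geom_sin; rewrite !sum_1_0; simpl; rewrite !Rmult_1_l; split; ring.
  - unfold geom_cos, geom_sin in *; rewrite !sum_1_S.
    set (x := INR (S m) * p) in *.
    replace (INR (S (S m)) * p) with (x + p) by (unfold x; rewrite (S_INR (S m)); ring).
    rewrite cos_plus, sin_plus, <- !tech_pow_Rmult with (n := S m).
    split; [transitivity (1 - r ^ S m * cos x + r ^ S m * ((1 - r * cos p) * cos x + r * sin p * sin x)) |
            transitivity (- (r ^ S m * sin x) + r ^ S m * ((1 - r * cos p) * sin x - r * sin p * cos x))];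
      [rewrite <- IHc; ring|ring|rewrite <- IHs; ring|ring].
Qed.

(** The frequencies 1..m lie below n and cancel over the vertices; only the constant term
    survives. *)
Lemma gon_sum_geom_cos r m t : (m < n)%nat -> gon_sum n (geom_cos r m) t = INR n.
Proof.
  induction m as [|m IH]; intros Hm.
  - rewrite (gon_sum_ext _ (fun _ => 1)); [rewrite gon_sum_const; ring|].
    intros; unfold geom_cos; rewrite sum_1_0; ring.
  - rewrite (gon_sum_ext _ (fun p => geom_cos r m p + r ^ S m * cos (INR (S m) * p))).
    + rewrite gon_sum_plus, IH, gon_sum_scal, gon_sum_cos by lia; ring.
    + intros; unfold geom_cos; rewrite sum_1_S; ring.
Qed.

Lemma gon_sum_geom_sin r m t : (m < n)%nat -> gon_sum n (geom_sin r m) t = 0.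
Proof.
  induction m as [|m IH]; intros Hm.
  - rewrite (gon_sum_ext _ (fun _ => 0)); [rewrite gon_sum_const; ring|].
    intros; unfold geom_sin; now rewrite sum_1_0.
  - rewrite (gon_sum_ext _ (fun p => geom_sin r m p + r ^ S m * sin (INR (S m) * p))).
    + rewrite gon_sum_plus, IH, gon_sum_scal, gon_sum_sin by lia; ring.
    + intros; unfold geom_sin; now rewrite sum_1_S.
Qed.

Lemma pole_dist_pos q c : 0 <= q < 1 -> -1 <= c <= 1 -> 0 < 1 - 2 * q * c + q ^ 2.
Proof. nra. Qed.

(** Up to the factor n / (1 - r^2), the Poisson kernel of radius r^n at angle n t. *)
Definition poisson (r t : R) : R :=
  INR n * (1 - (r ^ n) ^ 2) / ((1 - r ^ 2) * (1 - 2 * r ^ n * cos (INR n * t) + (r ^ n) ^ 2)).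

(** For w = r e^(ip), 1 / |1 - w|^2 = (2 Re (1 / (1 - w)) - 1) / (1 - r^2) and 1 / (1 - w) = (1 +
    ... + w^(n-1)) / (1 - w^n). As w^n is the same for all vertices, the sum falls on the geometric
    sums alone. *)
Lemma gon_sum_pot_1 r t : 0 <= r < 1 -> gon_sum n (pot 1 r) t = poisson r t.
Proof.
  intros Hr.
  assert (Hq := pow_lt_1 r n hn Hr).
  assert (HR : 0 < 1 - r ^ 2) by nra.
  (* Here 1 - w^n = A - iB, and E below is its squared modulus. *)
  set (A := 1 - r ^ n * cos (INR n * t)); set (B := r ^ n * sin (INR n * t)).
  set (E := 1 - 2 * r ^ n * cos (INR n * t) + (r ^ n) ^ 2).
  assert (HE : 0 < E) by (apply pole_dist_pos; [lra|apply COS_bound]).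
  assert (EAB : E = A ^ 2 + B ^ 2).
  { unfold E, A, B; generalize (sin2_cos2 (INR n * t)); unfold Rsqr; nra. }
  transitivity (gon_sum n (fun p =>
      2 * A / (E * (1 - r ^ 2)) * geom_cos r (pred n) p
      + (- (2 * B / (E * (1 - r ^ 2))) * geom_sin r (pred n) p + - / (1 - r ^ 2))) t).
  - apply sum_1_eq; intros j _.
    set (p := t - 2 * PI * INR j / INR n).
    assert (HD := sqdist_pos r p ltac:(lra)).
    destruct (geometric_sum r (pred n) p) as [Hc Hs].
    replace (S (pred n)) with n in Hc, Hs by lia.
    (* The angles n p and n t agree modulo 2 pi, so w^n does not depend on j. *)
    assert (Enp : INR n * p = INR n * t - 2 * INR j * PI) by (unfold p; field; lra).
    rewrite Enp, <- (cos_period (INR n * t - _) j) in Hc.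
    rewrite Enp, <- (sin_period (INR n * t - _) j) in Hs.
    replace (INR n * t - 2 * INR j * PI + 2 * INR j * PI) with (INR n * t) in Hc, Hs by ring.
    fold A in Hc; fold B in Hs.
    unfold pot; rewrite Rpower_Ropp, Rpower_1 by trivial.
    set (c := geom_cos r (pred n) p) in *; set (s := geom_sin r (pred n) p) in *.
    assert (ED : sqdist r p = (1 - r * cos p) ^ 2 + (r * sin p) ^ 2).
    { generalize (sin2_cos2 p); unfold sqdist, Rsqr; nra. }
    assert (HB : B = - ((1 - r * cos p) * s - r * sin p * c)) by (rewrite Hs; ring).
    assert (H1 : sqdist r p * c = (1 - r * cos p) * A + r * sin p * B).
    { rewrite ED, <- Hc, HB; ring. }
    assert (H2 : sqdist r p * s = r * sin p * A - (1 - r * cos p) * B).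
    { rewrite ED, <- Hc, HB; ring. }
    assert (H3 : sqdist r p * (c * A - s * B) = (1 - r * cos p) * E).
    { rewrite EAB; transitivity (sqdist r p * c * A - sqdist r p * s * B); [ring|].
      rewrite H1, H2; ring. }
    apply Rmult_eq_reg_l with (sqdist r p * (E * (1 - r ^ 2)));
      [|apply Rgt_not_eq; repeat apply Rmult_lt_0_compat; trivial].
    transitivity (E * (1 - r ^ 2)); [field; lra|].
    transitivity (2 * (sqdist r p * (c * A - s * B)) - sqdist r p * E); [|field; lra].
    rewrite H3; unfold sqdist; ring.
  - rewrite !gon_sum_plus, !gon_sum_scal, gon_sum_const, gon_sum_geom_cos, gon_sum_geom_sin by lia.
    unfold poisson; fold E.
    replace (1 - (r ^ n) ^ 2) with (2 * A - E) by (unfold E, A; ring).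
    field; lra.
Qed.

End Trigonometric_sums.

(** * Polar derivatives of the full potential *)

Definition gon_r n b r t := gon_sum n (pot_r b r) t.
Definition gon_t n b r t := gon_sum n (pot_t b r) t.
Definition gon_rr n b r t := gon_sum n (pot_rr b r) t.
Definition gon_tt n b r t := gon_sum n (pot_tt b r) t.

(** Where every base of [Rpower] is positive, so that the derivative formulas hold; points of the
    unit circle other than vertices are included. *)
Definition off_vertices (n : nat) (r t : R) : Prop :=
  forall j, (1 <= j <= n)%nat -> 0 < sqdist r (t - 2 * PI * INR j / INR n).

Lemma off_vertices_disc n r t : 0 <= r < 1 -> off_vertices n r t.
Proof. intros H j _; apply sqdist_pos; lra. Qed.

(** On the circle the squared chord is 4 sin^2(p/2). *)
Lemma sqdist_circle_pos p : - (2 * PI) < p < 0 -> 0 < sqdist 1 p.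
Proof.
  intros H.
  assert (0 < sin (- p / 2)) by (apply sin_gt_0; lra).
  unfold sqdist; replace p with (- (2 * (- p / 2))) by field.
  rewrite cos_neg, cos_2a_sin; nra.
Qed.

Lemma node_bounds n j : (1 <= j <= n)%nat ->
  2 * PI / INR n <= 2 * PI * INR j / INR n <= 2 * PI.
Proof.
  intros Hj.
  assert (0 < INR n) by (apply lt_0_INR; lia).
  assert (1 <= INR j) by (apply (le_INR 1); lia).
  assert (INR j <= INR n) by (apply le_INR; lia).
  generalize PI_RGT_0; intros HP.
  split; apply Rmult_le_reg_r with (INR n); trivial; field_simplify; nra.
Qed.

Lemma off_vertices_circle n t : 0 < t <= PI / INR n -> off_vertices n 1 t.
Proof.
  intros Ht j Hj; apply sqdist_circle_pos.
  generalize (node_bounds n j Hj) PI_RGT_0; intros.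
  assert (0 < PI / INR n) by lra; lra.
Qed.

Section Derivatives.

Variable n : nat.

Lemma is_derive_gon_sum_param (F : R -> R -> R) dF r t :
  (forall j, (1 <= j <= n)%nat ->
     is_derive (fun s => F s (t - 2 * PI * INR j / INR n)) r (dF (t - 2 * PI * INR j / INR n))) ->
  is_derive (fun s => gon_sum n (F s) t) r (gon_sum n dF t).
Proof. apply (sum_1_is_derive (fun j s => F s _)). Qed.

Lemma is_derive_gon_sum f df t :
  (forall j, (1 <= j <= n)%nat ->
     is_derive f (t - 2 * PI * INR j / INR n) (df (t - 2 * PI * INR j / INR n))) ->
  is_derive (gon_sum n f) t (gon_sum n df t).
Proof.
  intros H; apply (sum_1_is_derive (fun j s => f (s - _))); intros j Hj.
  evar_last.
  - apply (is_derive_comp f (fun s => s - 2 * PI * INR j / INR n)); [now apply H|].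
    auto_derive; trivial; reflexivity.
  - unfold scal; simpl; unfold mult; simpl; ring.
Qed.

Lemma is_derive_gon_r b r t :
  off_vertices n r t -> is_derive (fun s => gon_sum n (pot b s) t) r (gon_r n b r t).
Proof. intros H; apply is_derive_gon_sum_param; intros; now apply is_derive_pot_r, H. Qed.

Lemma is_derive_gon_t b r t :
  off_vertices n r t -> is_derive (gon_sum n (pot b r)) t (gon_t n b r t).
Proof. intros H; apply is_derive_gon_sum; intros; now apply is_derive_pot_t, H. Qed.

Lemma is_derive_gon_rr b r t :
  off_vertices n r t -> is_derive (fun s => gon_r n b s t) r (gon_rr n b r t).
Proof. intros H; apply is_derive_gon_sum_param; intros; now apply is_derive_pot_rr, H. Qed.

Lemma is_derive_gon_tt b r t :
  off_vertices n r t -> is_derive (gon_t n b r) t (gon_tt n b r t).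
Proof. intros H; apply is_derive_gon_sum; intros; now apply is_derive_pot_tt, H. Qed.

Lemma cont3_gon_r b r t : off_vertices n r t -> cont3 (gon_r n) b r t.
Proof. intros H; apply cont3_gon_sum; intros; now apply cont3_pot_r, H. Qed.

Lemma cont3_gon_t b r t : off_vertices n r t -> cont3 (gon_t n) b r t.
Proof. intros H; apply cont3_gon_sum; intros; now apply cont3_pot_t, H. Qed.

Lemma cont3_gon_rr b r t : off_vertices n r t -> cont3 (gon_rr n) b r t.
Proof. intros H; apply cont3_gon_sum; intros; now apply cont3_pot_rr, H. Qed.

Lemma cont3_gon_tt b r t : off_vertices n r t -> cont3 (gon_tt n) b r t.
Proof. intros H; apply cont3_gon_sum; intros; now apply cont3_pot_tt, H. Qed.

End Derivatives.

(** * Signs of the derivatives at the origin, on the circle and at exponent 1 *)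

Section Signs.

Variable n : nat.
Hypothesis hn : (3 <= n)%nat.

Let hN : 3 <= INR n.
Proof. replace 3 with (INR 3) by (simpl; lra); now apply le_INR. Qed.

Let npi : INR n * (PI / INR n) = PI.
Proof. field; lra. Qed.

(** At r = 0 each vertex contributes 2 b cos p, a harmonic of frequency 1, which cancels. *)
Lemma gon_r_origin b t : gon_r n b 0 t = 0.
Proof.
  transitivity (gon_sum n (fun p => 2 * b * cos (INR 1 * p)) t).
  - apply gon_sum_ext; intros p; unfold pot_r, sqdist.
    replace (1 + 0 ^ 2 - 2 * 0 * cos p) with 1 by ring.
    unfold Rpower; rewrite ln_1, Rmult_0_r, exp_0; simpl; rewrite Rmult_1_l; ring.
  - rewrite gon_sum_scal, gon_sum_cos by lia; ring.
Qed.

(** Here 4 b (b + 1) cos^2 p - 2 b splits into a constant and a harmonic of frequency 2, which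
    cancels because 2 < n. *)
Lemma gon_rr_origin b t : gon_rr n b 0 t = 2 * INR n * b ^ 2.
Proof.
  transitivity (gon_sum n (fun p => 2 * b ^ 2 + 2 * b * (b + 1) * cos (INR 2 * p)) t).
  - apply gon_sum_ext; intros p; unfold pot_rr, sqdist.
    replace (1 + 0 ^ 2 - 2 * 0 * cos p) with 1 by ring.
    unfold Rpower; rewrite ln_1, !Rmult_0_r, exp_0; simpl INR.
    replace (1 + 1) with 2 by ring; rewrite cos_2a_cos; ring.
  - rewrite gon_sum_plus, gon_sum_const, gon_sum_scal, gon_sum_cos by lia; ring.
Qed.

(** At r = 1 the factor 2 r - 2 cos p equals [sqdist 1 p], so each term of U_r is -b times the
    potential of its charge. *)
Lemma gon_r_circle b t :
  0 < b -> off_vertices n 1 t -> gon_r n b 1 t < 0.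
Proof.
  intros Hb H.
  assert (0 < gon_sum n (fun p => b * pot b 1 p) t).
  { apply sum_1_pos; [lia|]; intros j Hj.
    apply Rmult_lt_0_compat; trivial; apply exp_pos. }
  replace (gon_r n b 1 t) with (- 1 * gon_sum n (fun p => b * pot b 1 p) t); [lra|].
  rewrite <- gon_sum_scal; apply sum_1_eq; intros j Hj; specialize (H j Hj).
  set (p := t - _) in *; unfold pot_r, pot.
  unfold Rminus at 1; rewrite Rpower_plus, (Rpower_Ropp _ 1), Rpower_1 by trivial.
  unfold sqdist in *; field; lra.
Qed.

Lemma gon_t_1 r t : 0 < r < 1 ->
  gon_t n 1 r t =
    - (2 * INR n ^ 2 * r ^ n * (1 - (r ^ n) ^ 2) / (1 - r ^ 2))
    * (sin (INR n * t) / (1 - 2 * r ^ n * cos (INR n * t) + (r ^ n) ^ 2) ^ 2).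
Proof.
  intros Hr.
  assert (Hq := pow_lt_1 r n ltac:(lia) (conj (Rlt_le _ _ (proj1 Hr)) (proj2 Hr))).
  assert (D := is_derive_gon_t n 1 r t (off_vertices_disc n r t ltac:(lra))).
  apply (is_derive_ext _ (poisson n r)) in D.
  2:{ intros s; apply gon_sum_pot_1; [lia|lra]. }
  rewrite <- (is_derive_unique _ _ _ D); apply is_derive_unique.
  unfold poisson; set (q := r ^ n) in *.
  assert (HE := pole_dist_pos q (cos (INR n * t)) Hq (COS_bound _)).
  assert (0 < 1 - r ^ 2) by nra.
  auto_derive; [|field; lra].
  apply Rgt_not_eq, Rmult_lt_0_compat; simpl in *; lra.
Qed.

Lemma gon_t_1_neg r t : 0 < r < 1 -> 0 < t < PI / INR n -> gon_t n 1 r t < 0.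
Proof.
  intros Hr Ht; rewrite gon_t_1 by trivial.
  assert (Hq := pow_lt_1 r n ltac:(lia) (conj (Rlt_le _ _ (proj1 Hr)) (proj2 Hr))).
  assert (Hq' := pow_lt r n (proj1 Hr)).
  assert (HE := pole_dist_pos (r ^ n) (cos (INR n * t)) Hq (COS_bound _)).
  set (q := r ^ n) in *; set (E := 1 - 2 * q * _ + _) in *.
  assert (0 < sin (INR n * t)).
  { apply sin_gt_0; [nra|]. rewrite <- npi; apply Rmult_lt_compat_l; lra. }
  assert (0 < sin (INR n * t) / E ^ 2) by (apply Rdiv_lt_0_compat; trivial; now apply pow_lt).
  assert (0 < 2 * INR n ^ 2 * q * (1 - q ^ 2) / (1 - r ^ 2)).
  { apply Rdiv_lt_0_compat; [repeat apply Rmult_lt_0_compat|]; nra. }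
  nra.
Qed.

(** At t = pi/n the sine in U_t vanishes, so only its own derivative n cos(n t) = -n counts. *)
Lemma gon_tt_1_pos r : 0 < r < 1 -> 0 < gon_tt n 1 r (PI / INR n).
Proof.
  intros Hr.
  assert (Hq := pow_lt_1 r n ltac:(lia) (conj (Rlt_le _ _ (proj1 Hr)) (proj2 Hr))).
  assert (Hq' := pow_lt r n (proj1 Hr)).
  assert (D := is_derive_gon_tt n 1 r (PI / INR n) (off_vertices_disc n r _ ltac:(lra))).
  eapply is_derive_ext in D; [|intros s; apply gon_t_1; trivial].
  rewrite <- (is_derive_unique _ _ _ D); clear D.
  set (q := r ^ n) in *.
  set (K := 2 * INR n ^ 2 * q * (1 - q ^ 2) / (1 - r ^ 2)).
  assert (0 < K).
  { apply Rdiv_lt_0_compat; [repeat apply Rmult_lt_0_compat|]; nra. }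
  replace (Derive _ _) with (K * INR n / (1 + q) ^ 4).
  { apply Rdiv_lt_0_compat; [nra|apply pow_lt; lra]. }
  symmetry; apply is_derive_unique.
  assert (HE : 0 < 1 + 2 * q + q ^ 2) by nra.
  clearbody K; auto_derive; rewrite npi, cos_PI, ?sin_PI.
  - apply Rgt_not_eq; repeat apply Rmult_lt_0_compat; simpl in *; lra.
  - replace (1 - 2 * q * -1 + q ^ 2) with ((1 + q) ^ 2) by ring; field; lra.
Qed.

(** Allows the closed form to be simplified along one ray before it is differentiated in r. *)
Lemma gon_r_1 r t (f : R -> R) l :
  0 < r < 1 -> (forall s, 0 < s < 1 -> poisson n s t = f s) ->
  is_derive f r l -> gon_r n 1 r t = l.
Proof.
  intros Hr Hf D.
  assert (D' := is_derive_gon_r n 1 r t (off_vertices_disc n r t ltac:(lra))).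
  rewrite <- (is_derive_unique _ _ _ D), <- (is_derive_unique _ _ _ D').
  apply Derive_ext_loc.
  assert (He : 0 < Rmin r (1 - r)) by (apply Rmin_glb_lt; lra).
  exists (mkposreal _ He); intros s Hs.
  assert (Rabs (s - r) < Rmin r (1 - r)) by exact Hs.
  generalize (Rmin_l r (1 - r)) (Rmin_r r (1 - r)) (Rabs_def2 _ _ H); intros.
  rewrite <- Hf by lra; apply gon_sum_pot_1; [lia|lra].
Qed.

(** With cos(n t) = 1 the closed form becomes n (1 + r^n) / ((1 - r^2) (1 - r^n)), whose derivative
    is a sum of two positive terms. *)
Lemma gon_r_1_vertex_ray r : 0 < r < 1 -> 0 < gon_r n 1 r 0.
Proof.
  intros Hr.
  assert (Hq := pow_lt_1 r n ltac:(lia) (conj (Rlt_le _ _ (proj1 Hr)) (proj2 Hr))).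
  assert (Hq' := pow_lt r (pred n) (proj1 Hr)).
  assert (0 < 1 - r ^ 2) by nra.
  rewrite (gon_r_1 r 0 (fun s => INR n * (1 + s ^ n) / ((1 - s ^ 2) * (1 - s ^ n)))
    (2 * INR n ^ 2 * r ^ pred n / ((1 - r ^ 2) * (1 - r ^ n) ^ 2)
     + 2 * INR n * r * (1 + r ^ n) / ((1 - r ^ 2) ^ 2 * (1 - r ^ n)))); trivial.
  - apply Rplus_lt_0_compat; apply Rdiv_lt_0_compat;
      repeat (apply Rmult_lt_0_compat || apply pow_lt); lra.
  - intros s Hs; unfold poisson.
    assert (Hp := pow_lt_1 s n ltac:(lia) (conj (Rlt_le _ _ (proj1 Hs)) (proj2 Hs))).
    rewrite Rmult_0_r, cos_0.
    replace (1 - 2 * s ^ n * 1 + (s ^ n) ^ 2) with ((1 - s ^ n) ^ 2) by ring.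
    field; nra.
  - auto_derive.
    + apply Rgt_not_eq, Rmult_lt_0_compat; simpl in *; lra.
    + field; lra.
Qed.

Lemma gon_r_1_bisector r : 0 < r < 1 ->
  gon_r n 1 r (PI / INR n) =
    2 * INR n * r / ((1 - r ^ 2) ^ 2 * (1 + r ^ n) ^ 2) * saddle_fun n r.
Proof.
  intros Hr.
  assert (Hq := pow_lt_1 r n ltac:(lia) (conj (Rlt_le _ _ (proj1 Hr)) (proj2 Hr))).
  assert (0 < 1 - r ^ 2) by nra.
  apply (gon_r_1 r _ (fun s => INR n * (1 - s ^ n) / ((1 - s ^ 2) * (1 + s ^ n)))); trivial.
  - intros s Hs; unfold poisson.
    assert (Hp := pow_lt_1 s n ltac:(lia) (conj (Rlt_le _ _ (proj1 Hs)) (proj2 Hs))).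
    rewrite npi, cos_PI.
    replace (1 - 2 * s ^ n * -1 + (s ^ n) ^ 2) with ((1 + s ^ n) ^ 2) by ring.
    field; nra.
  - unfold saddle_fun; auto_derive.
    + apply Rgt_not_eq, Rmult_lt_0_compat; simpl in *; lra.
    + replace (2 * n)%nat with (n + n)%nat by lia.
      destruct n as [|[|m]]; try lia.
      replace (S (S m) - 2)%nat with m by lia; simpl pred.
      rewrite pow_add in *. change (r ^ S (S m)) with (r * (r * r ^ m)) in *.
      change (r ^ S m) with (r * r ^ m) in *.
      field; lra.
Qed.

(** Differentiating U_r = W [saddle_fun] at a root leaves W times [saddle_der], nonzero because the
    root is simple. *)
Lemma gon_rr_1_saddle r : 0 < r < 1 -> saddle_fun n r = 0 -> gon_rr n 1 r (PI / INR n) <> 0.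
Proof.
  intros Hr E.
  assert (Hq := pow_lt_1 r n ltac:(lia) (conj (Rlt_le _ _ (proj1 Hr)) (proj2 Hr))).
  assert (0 < 1 - r ^ 2) by nra.
  set (W := fun s => 2 * INR n * s / ((1 - s ^ 2) ^ 2 * (1 + s ^ n) ^ 2)).
  assert (DW : ex_derive W r).
  { unfold W; auto_derive; apply Rgt_not_eq;
      repeat apply Rmult_lt_0_compat; simpl in *; lra. }
  destruct DW as [w DW].
  assert (D := is_derive_scal_mult W (saddle_fun n) 1 r _ _ DW (is_derive_saddle_fun n hn r)).
  assert (D' := is_derive_gon_rr n 1 r (PI / INR n) (off_vertices_disc n r _ ltac:(lra))).
  assert (V : gon_rr n 1 r (PI / INR n) = W r * saddle_der n r).
  { rewrite <- (is_derive_unique _ _ _ D').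
    transitivity (Derive (fun y => 1 * W y * saddle_fun n y) r).
    - apply Derive_ext_loc.
      assert (He : 0 < Rmin r (1 - r)) by (apply Rmin_glb_lt; lra).
      exists (mkposreal _ He); intros s Hs.
      assert (Hs' : Rabs (s - r) < Rmin r (1 - r)) by exact Hs.
      generalize (Rmin_l r (1 - r)) (Rmin_r r (1 - r)) (Rabs_def2 _ _ Hs'); intros.
      rewrite gon_r_1_bisector by lra; unfold W; ring.
    - etransitivity; [apply is_derive_unique; exact D|rewrite E; ring]. }
  rewrite V.
  apply Rmult_integral_contrapositive_currified.
  - apply Rgt_not_eq, Rdiv_lt_0_compat; repeat (apply Rmult_lt_0_compat || apply pow_lt); lra.
  - now apply saddle_root_simple.
Qed.

End Signs.

(** * Critical points in the closed sector for exponents near 1 *)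

(** The polar form of a vanishing gradient for r > 0; the angular equation says nothing at r = 0, so
    the origin is treated apart. *)
Definition gon_crit n b r t := gon_r n b r t = 0 /\ gon_t n b r t = 0.

Lemma sqdist_period r p : sqdist r (p + 2 * PI) = sqdist r p.
Proof.
  unfold sqdist; replace (p + 2 * PI) with (p + 2 * INR 1 * PI) by (simpl; ring).
  now rewrite cos_period.
Qed.

Lemma pot_r_period b r p : pot_r b r (p + 2 * PI) = pot_r b r p.
Proof. unfold pot_r; now rewrite sqdist_period, cos_plus, cos_2PI, sin_2PI, Rmult_1_r, Rmult_0_r, Rminus_0_r. Qed.

Lemma pot_t_period b r p : pot_t b r (p + 2 * PI) = pot_t b r p.
Proof. unfold pot_t; now rewrite sqdist_period, sin_plus, cos_2PI, sin_2PI, Rmult_1_r, Rmult_0_r, Rplus_0_r. Qed.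

Section Compactness.

Variable n : nat.
Hypothesis hn : (3 <= n)%nat.

Let hN : 3 <= INR n.
Proof. replace 3 with (INR 3) by (simpl; lra); now apply le_INR. Qed.

Let hpn : 0 < PI / INR n.
Proof. apply Rdiv_lt_0_compat; [apply PI_RGT_0|lra]. Qed.

Lemma gon_r_reflect b r t : gon_r n b r (- t) = gon_r n b r t.
Proof.
  rewrite <- (Rmult_1_l (gon_r n b r t)); apply gon_sum_reflect; [lia|apply pot_r_period|].
  intros p; unfold pot_r, sqdist; rewrite cos_neg; ring.
Qed.

Lemma gon_t_reflect b r t : gon_t n b r (- t) = - gon_t n b r t.
Proof.
  replace (- gon_t n b r t) with (-1 * gon_t n b r t) by ring.
  apply gon_sum_reflect; [lia|apply pot_t_period|].
  intros p; unfold pot_t, sqdist; rewrite cos_neg, sin_neg; ring.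
Qed.

(** The angles pi/n and -pi/n differ by one rotation of the polygon, while U_t is odd in t. *)
Lemma gon_t_bisector b r : gon_t n b r (PI / INR n) = 0.
Proof.
  assert (gon_t n b r (PI / INR n) = gon_t n b r (- (PI / INR n))); [|rewrite gon_t_reflect in H; lra].
  unfold gon_t; rewrite <- (gon_sum_shift n _ ltac:(lia) (pot_t_period b r) (- (PI / INR n))).
  f_equal; field; lra.
Qed.

(** U_r vanishes at r = 0 and U_rr stays positive nearby, so the mean value theorem applies. *)
Lemma gon_r_near_origin t0 :
  exists d, 0 < d /\ forall b r t, near3 d 1 0 t0 b r t -> 0 < r < 1 -> 0 < gon_r n b r t.
Proof.
  destruct (cont3_same_sign (gon_rr n) 1 0 t0) as (d & Hd & H).
  { apply cont3_gon_rr, off_vertices_disc; lra. }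
  { rewrite gon_rr_origin by trivial; nra. }
  exists d; split; trivial; intros b r t (Hb & Hr & Ht) Hr1.
  destruct (MVT_is_derive (fun s => gon_r n b s t) (fun s => gon_rr n b s t) 0 r)
    as (c & Hc & E); [lra| |].
  { intros s Hs; apply is_derive_gon_rr, off_vertices_disc; lra. }
  rewrite gon_r_origin, !Rminus_0_r in E by trivial; rewrite E.
  assert (near3 d 1 0 t0 b c t).
  { repeat split; trivial; rewrite Rminus_0_r, Rabs_right in * by lra; lra. }
  specialize (H b c t H0); rewrite gon_rr_origin in H by trivial.
  apply Rmult_lt_0_compat; [nra|lra].
Qed.

Lemma gon_bisector_root :
  exists d, 0 < d /\ forall b, Rabs (b - 1) < d ->
    exists r, 0 < r < 1 /\ gon_r n b r (PI / INR n) = 0.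
Proof.
  destruct (gon_r_near_origin (PI / INR n)) as (d & Hd & H).
  (* The cap 1 ensures b > 0, and r1 < 1 below. *)
  exists (Rmin d 1); split; [apply Rmin_glb_lt; lra|]; intros b Hb.
  assert (Hm : 0 < Rmin d 1) by (apply Rmin_glb_lt; lra).
  generalize (Rmin_l d 1) (Rmin_r d 1) (Rabs_def2 _ _ Hb); intros Hm1 Hm2 Hb'.
  set (r1 := Rmin d 1 / 2).
  assert (Hr1 : 0 < r1 < 1) by (unfold r1; lra).
  assert (P : 0 < gon_r n b r1 (PI / INR n)).
  { apply H; trivial; repeat split; [lra| |].
    - rewrite Rminus_0_r, Rabs_right by lra; unfold r1; lra.
    - rewrite Rminus_diag, Rabs_R0; trivial. }
  assert (Q : gon_r n b 1 (PI / INR n) < 0).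
  { apply gon_r_circle; trivial; [lra|apply off_vertices_circle; lra]. }
  destruct (IVT_interv (fun s => - gon_r n b s (PI / INR n)) r1 1) as (r & Hr & E).
  - intros s Hs.
    assert (O : off_vertices n s (PI / INR n)).
    { destruct (Rle_lt_or_eq_dec s 1) as [Hs1|Hs1]; [lra| |].
      - apply off_vertices_disc; lra.
      - subst s; apply off_vertices_circle; lra. }
    apply continuity_pt_opp, derivable_continuous_pt.
    exists (gon_rr n b s (PI / INR n)); now apply is_derive_Reals, is_derive_gon_rr.
  - lra.
  - lra.
  - lra.
  - exists r; split; [|lra].
    (* The intermediate value theorem yields a closed interval; U_r < 0 at r = 1 excludes that
       end. *)
    destruct (Rle_lt_or_eq_dec r 1) as [Hr2|Hr2]; [lra|lra|subst r; lra].
Qed.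

(* At a critical point the radial and angular equations combine to
   [z - 1 . grad = 0]; the vertex at [1] contributes [-2 b |z - 1|^(-2b)] and the
   other vertices a quantity tending to [0] with [z - 1]. *)
Lemma gon_crit_near_vertex :
  exists d, 0 < d /\ forall b r t, near3 d 1 1 0 b r t -> 0 < r < 1 -> ~ gon_crit n b r t.
Proof.
  (* Writing n = m + 1 splits off the last vertex, which is the point 1. *)
  destruct n as [|m] eqn:En; [lia|].
  set (node := fun t j => t - 2 * PI * INR j / INR (S m)).
  (* [ang] is the angular derivative divided by r. *)
  set (ang := fun b r p => -2 * b * Rpower (sqdist r p) (- b - 1) * sin p).
  set (H := fun b r t => sum_n_m (fun j => pot_r b r (node t j)) 1 m).
  set (K := fun b r t => sum_n_m (fun j => ang b r (node t j)) 1 m).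
  assert (O : forall j, (1 <= j <= m)%nat -> 0 < sqdist 1 (node 0 j)).
  { intros j Hj; apply sqdist_circle_pos; unfold node.
    assert (Hlt : 2 * PI * INR j / INR (S m) < 2 * PI).
    { assert (INR j < INR (S m)) by (apply lt_INR; lia).
      generalize PI_RGT_0; intros.
      apply Rmult_lt_reg_r with (INR (S m)); [lra|field_simplify; nra]. }
    generalize (node_bounds (S m) j ltac:(lia)); lra. }
  assert (CH : cont3 H 1 1 0).
  { apply (cont3_sum (fun j b r t => pot_r b r (node t j))); intros j Hj.
    now apply (cont3_shift pot_r), cont3_pot_r, O. }
  assert (CK : cont3 K 1 1 0).
  { apply (cont3_sum (fun j b r t => ang b r (node t j))); intros j Hj.
    apply (cont3_shift ang); specialize (O j Hj); unfold node in O.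
    unfold ang, sqdist in *; continuity3. }
  (* The combination vanishes at the vertex, since r - cos t and sin t do, so it stays below 1
     nearby. *)
  destruct (cont3_near (fun b r t => (r - cos t) * H b r t + sin t * K b r t) 1 1 0 1)
    as (d1 & Hd1 & Hn1); [|lra|].
  { apply cont3_plus; apply cont3_mult; trivial; continuity3. }
  destruct (cont3_near (fun _ r t => sqdist r t) 1 1 0 1) as (d2 & Hd2 & Hn2); [|lra|].
  { unfold sqdist; continuity3. }
  set (d := Rmin (Rmin d1 d2) (1 / 2)).
  assert (Hd : 0 < d) by (repeat apply Rmin_glb_lt; lra).
  exists d; split; trivial.
  intros b r t (Hb & Hr & Ht) Hr1 [Er Et].
  assert (Hdd : d <= d1 /\ d <= d2 /\ d <= 1 / 2).
  { generalize (Rmin_l (Rmin d1 d2) (1 / 2)) (Rmin_r (Rmin d1 d2) (1 / 2))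
      (Rmin_l d1 d2) (Rmin_r d1 d2); fold d; lra. }
  specialize (Hn1 b r t); specialize (Hn2 b r t); simpl in Hn1, Hn2.
  rewrite cos_0, sin_0, Rminus_diag, !Rmult_0_l, Rplus_0_l, Rminus_0_r in Hn1.
  assert (S0 : sqdist 1 0 = 0) by (unfold sqdist; rewrite cos_0; ring).
  rewrite S0, Rminus_0_r in Hn2.
  assert (N1 := Rabs_def2 _ _ (Hn1 ltac:(repeat split; lra))).
  assert (N2 := Rabs_def2 _ _ (Hn2 ltac:(repeat split; lra))).
  clear Hn1 Hn2.
  assert (HD := sqdist_pos r t ltac:(lra)).
  assert (Elast : t - 2 * PI * INR (S m) / INR (S m) + 2 * PI = t) by (field; lra).
  assert (Er' : H b r t + pot_r b r t = 0).
  { rewrite <- Er; unfold gon_r, gon_sum; rewrite sum_1_S.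
    rewrite <- (pot_r_period b r (t - 2 * PI * INR (S m) / _)), Elast; reflexivity. }
  assert (Et' : K b r t + ang b r t = 0).
  { apply Rmult_eq_reg_l with r; [|lra].
    rewrite Rmult_0_r, <- Et; unfold gon_t, gon_sum; rewrite sum_1_S.
    rewrite <- (pot_t_period b r (t - 2 * PI * INR (S m) / _)), Elast.
    rewrite Rmult_plus_distr_l; f_equal; [unfold K; rewrite <- sum_1_scal; apply sum_1_eq; intros j _|];
      unfold ang, pot_t, node; ring. }
  assert (Hb' := Rabs_def2 _ _ Hb).
  assert (E : (r - cos t) * H b r t + sin t * K b r t = 2 * b * Rpower (sqdist r t) (- b)).
  { replace (H b r t) with (- pot_r b r t) by lra.
    replace (K b r t) with (- ang b r t) by lra.
    assert (PW : Rpower (sqdist r t) (- b - 1) = Rpower (sqdist r t) (- b) / sqdist r t).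
    { unfold Rminus; now rewrite Rpower_plus, (Rpower_Ropp _ 1), Rpower_1. }
    unfold pot_r, ang; rewrite PW.
    transitivity (2 * b * Rpower (sqdist r t) (- b) * ((r - cos t) ^ 2 + sin t ^ 2) / sqdist r t);
      [field; lra|rewrite <- sqdist_sos; field; lra]. }
  (* With squared distance below 1 and b > 1/2, the right side of [E] is at least 2 b > 1, against
     the bound [N1]. *)
  assert (1 <= Rpower (sqdist r t) (- b)).
  { unfold Rpower; rewrite <- exp_0 at 1.
    destruct (Rle_lt_or_eq_dec (sqdist r t) 1) as [HL|HL]; [lra| |].
    - apply Rlt_le, exp_increasing.
      assert (ln (sqdist r t) < 0) by (rewrite <- ln_1; apply ln_increasing; lra); nra.
    - rewrite HL, ln_1; right; f_equal; ring. }
  rewrite E in N1; nra.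
Qed.

(** The conclusion is uniform over the rectangle, ready for compactness: away from the saddle it
    holds because the box contains no critical point of the sector. *)
Lemma gon_crit_local rs e u v :
  0 < rs < 1 -> saddle_fun n rs = 0 -> 0 < e -> 0 <= u <= 1 -> 0 <= v <= PI / INR n ->
  exists d, 0 < d /\ forall b r t, near3 d 1 u v b r t ->
    0 < r < 1 -> 0 <= t <= PI / INR n -> gon_crit n b r t ->
    t = PI / INR n /\ Rabs (r - rs) < e.
Proof.
  intros Hrs Es He Hu Hv.
  assert (Z : forall F, cont3 F 1 u v -> F 1 u v <> 0 ->
    exists d, 0 < d /\ forall b r t, near3 d 1 u v b r t -> F b r t <> 0).
  { intros F CF HF; destruct (cont3_same_sign F 1 u v CF HF) as (d & Hd & H).
    exists d; split; trivial; intros b r t Hn E; specialize (H b r t Hn).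
    rewrite E, Rmult_0_r in H; lra. }
  destruct (Rle_lt_or_eq_dec 0 u) as [Hu0|Hu0]; [lra| |].
  2:{ subst u; destruct (gon_r_near_origin v) as (d & Hd & H).
      exists d; split; trivial; intros b r t Hn Hr _ [Er _].
      specialize (H b r t Hn Hr); lra. }
  (* Settles every point off the vertices where U_r does not vanish at exponent 1. *)
  assert (R : off_vertices n u v -> gon_r n 1 u v <> 0 ->
    exists d, 0 < d /\ forall b r t, near3 d 1 u v b r t ->
    0 < r < 1 -> 0 <= t <= PI / INR n -> gon_crit n b r t ->
    t = PI / INR n /\ Rabs (r - rs) < e).
  { intros O H; destruct (Z (gon_r n)) as (d & Hd & H'); [now apply cont3_gon_r|trivial|].
    exists d; split; trivial; intros b r t Hn _ _ [Er _]; now apply H' in Er. }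
  destruct (Rle_lt_or_eq_dec u 1) as [Hu1|Hu1]; [lra| |].
  2:{ destruct (Rle_lt_or_eq_dec 0 v) as [Hv0|Hv0]; [lra| |]; subst u.
      - assert (O : off_vertices n 1 v) by (apply off_vertices_circle; lra).
        apply R; trivial; apply Rlt_not_eq, gon_r_circle; trivial; lra.
      - subst v; destruct gon_crit_near_vertex as (d & Hd & H).
        exists d; split; trivial; intros b r t Hn Hr _ C; now apply H in C. }
  assert (O : off_vertices n u v) by (apply off_vertices_disc; lra).
  destruct (Rle_lt_or_eq_dec 0 v) as [Hv0|Hv0]; [lra| |].
  2:{ subst v; apply R; trivial; apply Rgt_not_eq, gon_r_1_vertex_ray; trivial; lra. }
  destruct (Rle_lt_or_eq_dec v (PI / INR n)) as [Hv1|Hv1]; [lra| |].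
  { destruct (Z (gon_t n)) as (d & Hd & H); [now apply cont3_gon_t| |].
    - apply Rlt_not_eq, gon_t_1_neg; trivial; lra.
    - exists d; split; trivial; intros b r t Hn _ _ [_ Et]; now apply H in Et. }
  subst v; destruct (Req_dec u rs) as [E|E].
  2:{ apply R; trivial; rewrite gon_r_1_bisector by (trivial; lra).
      assert (0 < 1 - u ^ 2) by nra.
      assert (0 < u ^ n) by now apply pow_lt.
      apply Rmult_integral_contrapositive_currified.
      - apply Rgt_not_eq, Rdiv_lt_0_compat;
          repeat (apply Rmult_lt_0_compat || apply pow_lt); lra.
      - intros Eu; apply E, (saddle_root_unique n hn); trivial; lra. }
  subst u; destruct (Z (gon_tt n)) as (d & Hd & H); [now apply cont3_gon_tt| |].
  { now apply Rgt_not_eq, gon_tt_1_pos. }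
  exists (Rmin d e); split; [now apply Rmin_glb_lt|].
  intros b r t (Hb & Hr & Ht) Hr1 Ht1 [_ Et].
  assert (Hd1 := Rmin_l d e); assert (Hd2 := Rmin_r d e).
  split; [|lra].
  destruct (Rle_lt_or_eq_dec t (PI / INR n)) as [Hlt|Heq]; [lra| |trivial].
  exfalso.
  (* A zero of U_t at t < pi/n, with the one on the bisector, would give a zero of U_tt between
     them, still inside the box. *)
  destruct (Rolle_is_derive (gon_t n b r) (gon_tt n b r) t (PI / INR n)) as (c & Hc & Ec);
    [lra| |now rewrite gon_t_bisector|].
  - intros s _; apply is_derive_gon_tt, off_vertices_disc; lra.
  - apply (H b r c); trivial; repeat split; try lra.
    rewrite Rabs_left in * by lra; lra.
Qed.

(** Compactness confines critical points to the bisector near [rs]; there U_rr does not vanish, so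
    Rolle leaves at most one, and the bisector root provides it. *)
Lemma gon_crit_sector :
  exists d, 0 < d /\ forall b, Rabs (b - 1) < d ->
    exists s, 0 < s < 1 /\
      forall r t, 0 < r < 1 -> 0 <= t <= PI / INR n ->
        (gon_crit n b r t <-> r = s /\ t = PI / INR n).
Proof.
  destruct gon_bisector_root as (d1 & Hd1 & Hroot).
  destruct (Hroot 1) as (rs & Hrs & Es); [rewrite Rminus_diag, Rabs_R0; trivial|].
  rewrite gon_r_1_bisector in Es by trivial.
  assert (Hs : saddle_fun n rs = 0).
  { assert (0 < 1 - rs ^ 2) by nra.
    assert (0 < rs ^ n) by now apply pow_lt.
    apply Rmult_integral in Es; destruct Es as [Es|Es]; trivial; exfalso; revert Es.
    apply Rgt_not_eq, Rdiv_lt_0_compat;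
      repeat (apply Rmult_lt_0_compat || apply pow_lt); lra. }
  destruct (cont3_same_sign (gon_rr n) 1 rs (PI / INR n)) as (e & He & Hrr).
  { apply cont3_gon_rr, off_vertices_disc; lra. }
  { now apply gon_rr_1_saddle. }
  assert (Hloc : forall u v, exists d : posreal, 0 <= u <= 1 -> 0 <= v <= PI / INR n ->
     forall b r t, near3 d 1 u v b r t ->
       0 < r < 1 -> 0 <= t <= PI / INR n -> gon_crit n b r t ->
       t = PI / INR n /\ Rabs (r - rs) < e).
  { intros u v.
    destruct (classic (0 <= u <= 1 /\ 0 <= v <= PI / INR n)) as [[Hu Hv]|Hn].
    - destruct (gon_crit_local rs e u v) as (d & Hd & H); trivial.
      now exists (mkposreal d Hd).
    (* The gauge must be defined on the whole plane; outside the rectangle its value is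
       arbitrary. *)
    - exists (mkposreal 1 Rlt_0_1); tauto. }
  set (delta := fun u v => proj1_sig (constructive_indefinite_description _ (Hloc u v))).
  (* Each point of the rectangle lies in the box of some (u, v) whose gauge is at least [d], so |b -
     1| < d brings the exponent within range as well. *)
  destruct (compactness_value_2d 0 1 0 (PI / INR n) delta) as [d Hd].
  assert (Hm : 0 < Rmin d (Rmin d1 e)).
  { repeat apply Rmin_glb_lt; trivial; apply cond_pos. }
  exists (Rmin d (Rmin d1 e)); split; trivial.
  intros b Hb.
  assert (Hbb : Rabs (b - 1) < d /\ Rabs (b - 1) < d1 /\ Rabs (b - 1) < e).
  { generalize (Rmin_l d (Rmin d1 e)) (Rmin_r d (Rmin d1 e)) (Rmin_l d1 e) (Rmin_r d1 e); lra. }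
  assert (Hall : forall r t, 0 < r < 1 -> 0 <= t <= PI / INR n -> gon_crit n b r t ->
            t = PI / INR n /\ Rabs (r - rs) < e).
  (* The covering property comes doubly negated, hence the argument by contradiction. *)
  { intros r t Hr Ht C; apply NNPP; intros HN.
    apply (Hd r t); [lra|trivial|].
    intros (u & v & Hu & Hv & Hru & Htv & Hdd); apply HN.
    revert Hru Htv Hdd; unfold delta.
    destruct (constructive_indefinite_description _ (Hloc u v)) as [d' Hd']; simpl.
    intros Hru Htv Hdd; apply (Hd' Hu Hv b r t); trivial; repeat split; lra. }
  destruct (Hroot b) as (s & Hs1 & Er); [lra|].
  assert (Cs : gon_crit n b s (PI / INR n)) by (split; [trivial|apply gon_t_bisector]).
  exists s; split; trivial; intros r t Hr Ht; split.
  - intros C; destruct (Hall r t Hr Ht C) as [Et Hre]; split; trivial; subst t.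
    destruct (Hall s (PI / INR n) Hs1 ltac:(lra) Cs) as [_ Hse].
    assert (Hno : forall x y, 0 < x -> x < y -> y < 1 -> Rabs (x - rs) < e -> Rabs (y - rs) < e ->
              gon_r n b x (PI / INR n) = gon_r n b y (PI / INR n) -> False).
    { intros x y Hx Hxy Hy Hx' Hy' E.
      destruct (Rolle_is_derive (fun s => gon_r n b s (PI / INR n))
                  (fun s => gon_rr n b s (PI / INR n)) x y) as (c & Hc & Ec); trivial.
      - intros z Hz; apply is_derive_gon_rr, off_vertices_disc; lra.
      - assert (Hn : near3 e 1 rs (PI / INR n) b c (PI / INR n)).
        { apply Rabs_def2 in Hx'; apply Rabs_def2 in Hy'.
          repeat split; [lra| |rewrite Rminus_diag, Rabs_R0; trivial].
          apply Rabs_def1; lra. }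
        specialize (Hrr _ _ _ Hn); rewrite Ec, Rmult_0_r in Hrr; lra. }
    destruct C as [C _]; destruct (Rtotal_order r s) as [H|[H|H]]; trivial; exfalso.
    + apply (Hno r s); trivial; lra.
    + apply (Hno s r); trivial; lra.
  - intros [-> ->]; exact Cs.
Qed.

End Compactness.

(** * Polar coordinates in the plane *)

Lemma Cmod_polar r t : Cmod (polar r t) = Rabs r.
Proof.
  unfold Cmod, polar; simpl.
  replace (r * cos t * (r * cos t * 1) + r * sin t * (r * sin t * 1)) with (Rsqr r).
  - apply sqrt_Rsqr_abs.
  - generalize (sin2_cos2 t); unfold Rsqr; nra.
Qed.

(** The angle is acos(x/r), with the sign of y. *)
Lemma polar_surj z : exists r t, 0 <= r /\ z = polar r t.
Proof.
  destruct z as [x y]; set (r := Cmod (x, y)).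
  destruct (Rle_lt_or_eq_dec 0 r) as [Hr|Hr]; [apply Cmod_ge_0| |].
  2:{ exists 0, 0; split; [lra|].
      rewrite (Cmod_eq_0 (x, y)) by (symmetry; exact Hr).
      unfold polar; now rewrite !Rmult_0_l. }
  assert (E : r ^ 2 = x ^ 2 + y ^ 2).
  { unfold r, Cmod; simpl fst; simpl snd; rewrite pow2_sqrt; nra. }
  assert (Hc : -1 <= x / r <= 1).
  { split; apply Rmult_le_reg_r with r; trivial; field_simplify; nra. }
  assert (Hs : r * sin (acos (x / r)) = Rabs y).
  { rewrite sin_acos by trivial.
    rewrite <- (sqrt_Rsqr r) at 1 by lra.
    rewrite <- sqrt_mult, <- sqrt_Rsqr_abs.
    - f_equal; unfold Rsqr; field_simplify; nra.
    - apply Rle_0_sqr.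
    - unfold Rsqr; nra. }
  destruct (Rle_lt_dec 0 y) as [Hy|Hy].
  - exists r, (acos (x / r)); split; [lra|]; unfold polar.
    rewrite cos_acos, Hs, Rabs_right by lra; f_equal; field; lra.
  - exists r, (- acos (x / r)); split; [lra|]; unfold polar.
    rewrite cos_neg, sin_neg, cos_acos by trivial.
    replace (r * - sin (acos (x / r))) with (- (r * sin (acos (x / r)))) by ring.
    rewrite Hs, Rabs_left by lra; f_equal; field; lra.
Qed.

Lemma polar_period_nat r t (k : nat) : polar r (t + INR k * (2 * PI)) = polar r t.
Proof.
  unfold polar; replace (t + INR k * (2 * PI)) with (t + 2 * INR k * PI) by ring.
  now rewrite cos_period, sin_period.
Qed.

Lemma polar_period r t (k : Z) : polar r (t + IZR k * (2 * PI)) = polar r t.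
Proof.
  destruct (Z.le_ge_cases 0 k) as [H|H].
  - rewrite <- (Z2Nat.id k H), <- INR_IZR_INZ; apply polar_period_nat.
  - rewrite <- (polar_period_nat _ _ (Z.to_nat (- k))); f_equal.
    rewrite (INR_IZR_INZ (Z.to_nat _)), Z2Nat.id, opp_IZR by lia; ring.
Qed.

(** Equal points would make the squared chord [sqdist 1 (x - y)] zero. *)
Lemma polar_inj s x y : 0 < s -> x < y < x + 2 * PI -> polar s x <> polar s y.
Proof.
  intros Hs Hxy E; injection E as Ec Es.
  apply Rmult_eq_reg_l in Ec; [|lra]; apply Rmult_eq_reg_l in Es; [|lra].
  assert (0 < sqdist 1 (x - y)) by (apply sqdist_circle_pos; lra).
  unfold sqdist in H; rewrite cos_minus, Ec, Es in H.
  generalize (sin2_cos2 y); unfold Rsqr; lra.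
Qed.

(** * The planar gradient and the polar equations *)

Section Gradient.

Variables (n : nat) (b : R).

Lemma Cmod_polar_vertex r t j :
  Cmod (polar r t - vertex n j) = sqrt (sqdist r (t - 2 * PI * INR j / INR n)).
Proof.
  unfold Cmod, vertex, polar, sqdist; f_equal; simpl.
  set (a := 2 * PI * INR j / INR n); rewrite cos_minus.
  generalize (sin2_cos2 t) (sin2_cos2 a); unfold Rsqr; intros Ht Ha.
  transitivity (r * r * (sin t * sin t + cos t * cos t) + (sin a * sin a + cos a * cos a)
                - 2 * r * (cos t * cos a + sin t * sin a)); [ring|rewrite Ht, Ha; ring].
Qed.

Lemma riesz_potential_polar r t :
  -1 < r < 1 -> riesz_potential n b (polar r t) = gon_sum n (pot b r) t.
Proof.
  intros Hr; apply sum_1_eq; intros j _.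
  assert (H := sqdist_pos r (t - 2 * PI * INR j / INR n) Hr).
  unfold pot; rewrite Cmod_polar_vertex, <- Rpower_sqrt, Rpower_mult by trivial.
  f_equal; field.
Qed.

Lemma riesz_potential_differentiable z :
  Cmod z < 1 -> exists lx ly,
    differentiable_pt_lim (fun x y => riesz_potential n b (x, y)) (Re z) (Im z) lx ly.
Proof.
  destruct (polar_surj z) as (r & t & Hr & ->).
  rewrite Cmod_polar, Rabs_right by lra; intros Hr1.
  apply sum_1_differentiable; intros j _.
  destruct (vertex n j) as [p q] eqn:Ev.
  set (x := Re (polar r t)); set (y := Im (polar r t)).
  set (Q := fun u v => (u - p) ^ 2 + (v - q) ^ 2).
  assert (HQ : 0 < Q x y).
  { assert (H := sqdist_pos r (t - 2 * PI * INR j / INR n) ltac:(lra)).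
    rewrite <- (pow2_sqrt (sqdist _ _)), <- Cmod_polar_vertex, Ev in H by lra.
    unfold Cmod in H; rewrite pow2_sqrt in H.
    - exact H.
    - apply Rplus_le_le_0_compat; apply pow2_ge_0. }
  (* One partial derivative that exists nearby and is continuous at the point, with the other at the
     point, suffices. *)
  assert (DQ : differentiable_pt_lim Q x y (2 * (x - p)) (2 * (y - q))).
  { apply filterdiff_differentiable_pt_lim.
    generalize (is_derive_filterdiff Q x y (fun u _ => 2 * (u - p)) (2 * (y - q))).
    intros H; apply H; clear H.
    - apply filter_forall; intros [u v]; unfold Q; simpl fst; simpl snd.
      auto_derive; trivial; ring.
    - unfold Q; auto_derive; trivial; ring.
    - apply (continuous_comp fst (fun u => 2 * (u - p))); [apply continuous_fst|].
      apply (ex_derive_continuous (fun u => 2 * (u - p))); auto_derive; trivial. }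
  assert (DP : is_derive (fun u => Rpower (sqrt u) (- 2 * b)) (Q x y)
                 (- 2 * b * Rpower (sqrt (Q x y)) (- 2 * b - 1) * / (2 * sqrt (Q x y)))).
  { apply (is_derive_Rpower_comp sqrt); [now apply sqrt_lt_R0|].
    auto_derive; trivial; ring. }
  apply is_derive_Reals in DP.
  (* The outer power is viewed as a function of two variables, the second a dummy, to fit the planar
     chain rule. *)
  apply (differentiable_pt_lim_proj1_0 _ _ 0) in DP.
  assert (DZ : differentiable_pt_lim (fun _ _ => 0) x y 0 0).
  { apply (differentiable_pt_lim_proj1_0 (fun _ => 0)), derivable_pt_lim_const. }
  do 2 eexists.
  exact (differentiable_pt_lim_comp _ _ _ _ _ _ _ _ _ _ _ DP DQ DZ).
Qed.

Lemma Derive_along_curve (f : C -> R) (g h : R -> R) (s lx ly dg dh : R) :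
  differentiable_pt_lim (fun x y => f (x, y)) (g s) (h s) lx ly ->
  is_derive g s dg -> is_derive h s dh ->
  Derive (fun u => f (g u, h u)) s = lx * dg + ly * dh.
Proof.
  intros Df Dg Dh.
  apply is_derive_Reals in Dg; apply is_derive_Reals in Dh.
  apply (differentiable_pt_lim_proj1_0 _ _ 0) in Dg.
  apply (differentiable_pt_lim_proj1_0 _ _ 0) in Dh.
  exact (proj1 (differentiable_pt_lim_unique _ _ _ _ _
           (differentiable_pt_lim_comp _ _ _ _ _ _ _ _ _ _ _ Df Dg Dh))).
Qed.

(** Chain rule along the ray and along the circle. The case r = 0 is kept for the origin. *)
Lemma gradient_polar r t g :
  0 <= r < 1 -> is_gradient (riesz_potential n b) (polar r t) g ->
  gon_r n b r t = Re g * cos t + Im g * sin t /\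
  gon_t n b r t = Re g * (- (r * sin t)) + Im g * (r * cos t).
Proof.
  intros Hr G.
  assert (O := off_vertices_disc n r t Hr).
  split.
  - rewrite <- (is_derive_unique _ _ _ (is_derive_gon_r n b r t O)).
    transitivity (Derive (fun s => riesz_potential n b (s * cos t, s * sin t)) r).
    + apply Derive_ext_loc.
      assert (He : 0 < 1 - r) by lra.
      exists (mkposreal _ He); intros s Hs.
      assert (Hs' : Rabs (s - r) < 1 - r) by exact Hs.
      apply Rabs_def2 in Hs'.
      symmetry; apply (riesz_potential_polar s t); lra.
    + apply (Derive_along_curve (riesz_potential n b) (fun s => s * cos t) (fun s => s * sin t)).
      * exact G.
      * auto_derive; trivial; ring.
      * auto_derive; trivial; ring.
  - rewrite <- (is_derive_unique _ _ _ (is_derive_gon_t n b r t O)).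
    transitivity (Derive (fun s => riesz_potential n b (r * cos s, r * sin s)) t).
    + apply Derive_ext; intros s.
      symmetry; apply (riesz_potential_polar r s); lra.
    + apply (Derive_along_curve (riesz_potential n b) (fun s => r * cos s) (fun s => r * sin s)).
      * exact G.
      * auto_derive; trivial; ring.
      * auto_derive; trivial; ring.
Qed.

Lemma gradient_exists z : Cmod z < 1 -> exists g, is_gradient (riesz_potential n b) z g.
Proof.
  intros Hz; destruct (riesz_potential_differentiable z Hz) as (lx & ly & H).
  now exists (lx, ly).
Qed.

Lemma critical_point_polar r t :
  0 < r < 1 -> (critical_point (riesz_potential n b) (polar r t) <-> gon_crit n b r t).
Proof.
  intros Hr; split.
  - intros [_ G]; apply gradient_polar in G; [|lra].
    simpl in G; destruct G as [Gr Gt]; split; [rewrite Gr|rewrite Gt]; ring.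
  - intros [Er Et].
    assert (Hz : Cmod (polar r t) < 1) by (rewrite Cmod_polar, Rabs_right; lra).
    destruct (gradient_exists _ Hz) as [[lx ly] G]; split; trivial.
    destruct (gradient_polar r t _ ltac:(lra) G) as [Gr Gt].
    rewrite Er in Gr; rewrite Et in Gt; simpl in Gr, Gt.
    (* Division by r > 0; the radial and angular components are then those of the gradient rotated
       by t, and the rotation is inverted. *)
    assert (Gt' : - lx * sin t + ly * cos t = 0).
    { apply Rmult_eq_reg_l with r; lra. }
    assert (T := sin2_cos2 t); unfold Rsqr in T.
    replace (RtoC 0) with ((lx, ly) : C); trivial.
    unfold RtoC; f_equal.
    + transitivity (lx * (sin t * sin t + cos t * cos t)); [rewrite T; ring|].
      transitivity ((lx * cos t + ly * sin t) * cos t - (- lx * sin t + ly * cos t) * sin t);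
        [ring|rewrite <- Gr, Gt'; ring].
    + transitivity (ly * (sin t * sin t + cos t * cos t)); [rewrite T; ring|].
      transitivity ((lx * cos t + ly * sin t) * sin t + (- lx * sin t + ly * cos t) * cos t);
        [ring|rewrite <- Gr, Gt'; ring].
Qed.

Lemma polar_0 t : polar 0 t = RtoC 0.
Proof. unfold polar; now rewrite !Rmult_0_l. Qed.

(** U_r vanishes at the origin in all directions; the directions 0 and pi/2 give the two components
    of the gradient. *)
Lemma critical_point_origin :
  (3 <= n)%nat -> critical_point (riesz_potential n b) (RtoC 0).
Proof.
  intros hn.
  assert (H0 : Cmod (RtoC 0) < 1) by (rewrite Cmod_0; lra).
  destruct (gradient_exists _ H0) as [[lx ly] G]; split; trivial.
  assert (Gx := G); rewrite <- (polar_0 0) in Gx.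
  assert (Gy := G); rewrite <- (polar_0 (PI / 2)) in Gy.
  apply gradient_polar in Gx; [|lra]; apply gradient_polar in Gy; [|lra].
  rewrite gon_r_origin in Gx, Gy by trivial.
  rewrite cos_0, sin_0 in Gx; rewrite cos_PI2, sin_PI2 in Gy; simpl in Gx, Gy.
  replace (RtoC 0) with ((lx, ly) : C) at 2; trivial.
  unfold RtoC; f_equal; lra.
Qed.

End Gradient.

(** * From the sector to the whole disc *)

(** Take [k] with k h nearest to t, and for [t0] the distance. *)
Lemma angle_reduction (h t : R) :
  0 < h -> exists t0 (k : Z), 0 <= t0 <= h / 2 /\
    (t = t0 + IZR k * h \/ t = - t0 + IZR k * h).
Proof.
  intros Hh; set (k := Int_part (t / h + 1 / 2)).
  destruct (base_Int_part (t / h + 1 / 2)) as [H1 H2]; fold k in H1, H2.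
  assert (E : t = t / h * h) by (field; lra).
  set (x := t / h) in *.
  exists (Rabs (t - IZR k * h)), k; split; [split; [apply Rabs_pos|]|].
  - apply Rabs_le; split; nra.
  - unfold Rabs; destruct (Rcase_abs _); [right|left]; ring.
Qed.

Lemma gon_crit_all n b s :
  (3 <= n)%nat -> 0 < s < 1 ->
  (forall r t, 0 < r < 1 -> 0 <= t <= PI / INR n ->
     (gon_crit n b r t <-> r = s /\ t = PI / INR n)) ->
  forall r t, 0 < r < 1 ->
    (gon_crit n b r t <->
     r = s /\ exists k : Z, t = PI / INR n + IZR k * (2 * PI / INR n)).
Proof.
  intros hn Hs H r t Hr.
  assert (hN : 3 <= INR n) by (replace 3 with (INR 3) by (simpl; lra); now apply le_INR).
  assert (HP := PI_RGT_0).
  assert (Hh : 0 < 2 * PI / INR n) by (apply Rdiv_lt_0_compat; lra).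
  assert (Eh : 2 * PI / INR n / 2 = PI / INR n) by (field; lra).
  assert (Sh : forall t k, gon_crit n b r (t + IZR k * (2 * PI / INR n)) <-> gon_crit n b r t).
  { intros u k; unfold gon_crit, gon_r, gon_t.
    rewrite gon_sum_shift_Z by (trivial; try lia; apply pot_r_period).
    rewrite gon_sum_shift_Z by (trivial; try lia; apply pot_t_period); tauto. }
  split.
  - intros Ct; destruct (angle_reduction _ t Hh) as (t0 & k & Ht0 & Et).
    rewrite Eh in Ht0.
    destruct Et as [-> | ->]; rewrite Sh in Ct.
    + apply H in Ct; trivial; destruct Ct as [-> ->]; split; trivial; now exists k.
    + assert (C0 : gon_crit n b r t0).
      { destruct Ct as [Cr Ct]; rewrite gon_r_reflect in Cr by trivial.
        rewrite gon_t_reflect in Ct by trivial; split; lra. }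
      apply H in C0; trivial; destruct C0 as [-> ->]; split; trivial.
      (* The reflected bisector -pi/n is pi/n turned back by one step. *)
      exists (k - 1)%Z; rewrite minus_IZR; field; lra.
  - intros [-> [k ->]]; apply Sh, H; trivial; split; trivial.
    + apply Rlt_le; lra.
    + lra.
Qed.

(** * Counting the critical points *)

Theorem theorem5p3 (n : nat) (hn : (3 <= n)%nat) :
  exists beta_l beta_r : R,
    beta_l < 1 < beta_r /\
    forall beta : R, beta_l < beta < beta_r ->
      has_exactly (n + 1) (critical_point (riesz_potential n beta)) /\
      (forall k : nat, Nat.Odd k -> (1 <= k <= 2 * n - 1)%nat ->
         exists! z : C,
           z <> RtoC 0 /\ on_ray (PI * INR k / INR n) z /\
           critical_point (riesz_potential n beta) z) /\
      critical_point (riesz_potential n beta) (RtoC 0).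
Proof.
  destruct (gon_crit_sector n hn) as (d & Hd & Hsec).
  exists (1 - d), (1 + d); split; [lra|]; intros b Hb.
  destruct (Hsec b) as (s & Hs & H); [apply Rabs_def1; lra|].
  assert (Hall := gon_crit_all n b s hn Hs H); clear H Hsec.
  assert (hN : 3 <= INR n) by (replace 3 with (INR 3) by (simpl; lra); now apply le_INR).
  assert (HP := PI_RGT_0).
  set (h := 2 * PI / INR n) in *.
  assert (Hh : 0 < h) by (apply Rdiv_lt_0_compat; lra).
  assert (Enh : INR n * h = 2 * PI) by (unfold h; field; lra).
  (* [P k] is the saddle on the bisector of odd number 2 k + 1. *)
  set (P := fun k : nat => polar s (PI / INR n + INR k * h)).
  assert (Hns : forall t, polar s t <> RtoC 0).
  { intros t E; assert (M := Cmod_polar s t).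
    rewrite E, Cmod_0, Rabs_right in M; lra. }
  assert (HC : forall k, critical_point (riesz_potential n b) (P k)).
  { intros k; apply critical_point_polar; trivial; apply Hall; trivial; split; trivial.
    exists (Z.of_nat k); now rewrite <- INR_IZR_INZ. }
  assert (H0 := critical_point_origin n b hn).
  split; [|split; trivial].
  - exists (RtoC 0 :: map P (seq 0 n)); split; [|split].
    + constructor.
      * rewrite in_map_iff; intros (k & E & _); now apply Hns in E.
      * apply Injective_map_NoDup_in; [|apply seq_NoDup].
        assert (Hlt : forall i j, (i < j < n)%nat -> P i <> P j).
        { intros i j Hij; apply polar_inj; [lra|].
          assert (INR i < INR j) by (apply lt_INR; lia).
          assert (INR j < INR n) by (apply lt_INR; lia).
          assert (0 <= INR i) by apply pos_INR.
          nra. }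
        intros i j Hi Hj E; apply in_seq in Hi; apply in_seq in Hj.
        destruct (Nat.lt_trichotomy i j) as [L|[L|L]]; trivial; exfalso.
        -- apply (Hlt i j); [lia|trivial].
        -- apply (Hlt j i); [lia|now symmetry].
    + simpl; rewrite length_map, length_seq; lia.
    + intros z; split.
      * intros [<-|Hz]; trivial.
        apply in_map_iff in Hz; destruct Hz as (k & <- & _); apply HC.
      * intros Cz; destruct (polar_surj z) as (r & t & Hr & ->).
        destruct (Rle_lt_or_eq_dec 0 r Hr) as [Hr0|<-]; [right|left; now rewrite polar_0].
        assert (Hr1 : r < 1).
        { destruct Cz as [M _]; rewrite Cmod_polar, Rabs_right in M; lra. }
        apply critical_point_polar in Cz; [|lra].
        apply Hall in Cz; [|lra]; destruct Cz as [-> [k ->]].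
        (* The integer number of turns is reduced modulo n, the quotient being absorbed by the
           period 2 pi. *)
        apply in_map_iff; exists (Z.to_nat (k mod Z.of_nat n)).
        assert (Hm := Z.mod_pos_bound k (Z.of_nat n) ltac:(lia)).
        split; [|apply in_seq; lia].
        unfold P; rewrite <- (polar_period s _ (k / Z.of_nat n)); f_equal.
        rewrite (INR_IZR_INZ (Z.to_nat _)), Z2Nat.id by lia.
        rewrite (Z.div_mod k (Z.of_nat n)) at 3 by lia.
        rewrite plus_IZR, mult_IZR, <- INR_IZR_INZ, <- Enh; ring.
  - intros k [m ->] _.
    assert (Ek : PI * INR (2 * m + 1) / INR n = PI / INR n + INR m * h).
    { rewrite plus_INR, mult_INR; unfold h; simpl; field; lra. }
    rewrite Ek; exists (P m); split.
    + split; [apply Hns|split; [|apply HC]].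
      exists s; split; [lra|reflexivity].
    + intros z (Hz & (r & Hr & ->) & Cz).
      destruct (Rle_lt_or_eq_dec 0 r Hr) as [Hr0|<-]; [|now rewrite polar_0 in Hz].
      assert (Hr1 : r < 1).
      { destruct Cz as [M _]; rewrite Cmod_polar, Rabs_right in M; lra. }
      apply critical_point_polar in Cz; [|lra].
      apply Hall in Cz; [|lra]; destruct Cz as [-> _]; reflexivity.
Qed.
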